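(* Let $K$ be a number field with ring of integers $\mathcal O_K$, let $k\ge 2$ be an integer, and let $A:\mathcal O_K\to\mathcal O_K$ be a $\mathbb Z$-linear bijection. For every prime number $p$, denote also by $A$ the induced $\mathbb Z$-linear bijection $\mathcal O_K/p^k\mathcal O_K\to\mathcal O_K/p^k\mathcal O_K$. Then the following are equivalent: (a) $A(V_{K,k})=V_{K,k}$. (b) $A(V_{K,k,p})=V_{K,k,p}$ for all prime numbers $p$. (c) $A$ is the composition $M_\varepsilon\circ\tau$ of (the restriction to $\mathcal O_K$ of) a field automorphism $\tau$ of $K$ and the multiplication map $M_\varepsilon:x\mapsto\varepsilon x$ for some unit $\varepsilon\in\mathcal O_K^\times$.
   Context: $V_{K,k}$ is the set of $k$-free integers of $K$: the set of $x\in\mathcal O_K$ that are not divisible by the $k$-th power $\mathfrak p^k$ of any (nonzero) prime ideal $\mathfrak p$ of $\mathcal O_K$, i.e. $x\notin\mathfrak p^k$ for all $\mathfrak p$. For a prime number $p$, $V_{K,k,p}\subseteq\mathcal O_K/p^k\mathcal O_K$ is the set of residue classes modulo $p^k$ that are not divisible by the $k$-th power of any prime ideal dividing $p$ (i.e. classes of $x$ with $x\notin\mathfrak p^k$ for all $\mathfrak p\mid p$; this is well defined since $p^k\in\mathfrak p^k$). The field $K$ is not assumed to be normal over $\mathbb Q$. *)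

(* Defs.v *)
From HB Require Import structures.
From mathcomp Require Import all_boot all_order all_algebra all_field.
From mathcomp Require Import boolp classical_sets.

Set Implicit Arguments.
Unset Strict Implicit.
Unset Printing Implicit Defensive.

Import GRing.Theory.
Local Open Scope ring_scope.
Local Open Scope quotient_scope.
Local Open Scope classical_set_scope.

(* A number field is a finite extension of the rationals: K : fieldExtType rat. *)

Section RingOfIntegers.
Variable K : fieldExtType rat.

Definition isIntegral : {pred K} :=
  fun x => `[< integralOver (intr : int -> K) x >].

Lemma isIntegralP (x : K) :
  reflect (integralOver (intr : int -> K) x) (x \in isIntegral).
Proof. exact: asboolP. Qed.

Lemma isIntegral_subring : subring_closed isIntegral.
Proof.
split=> [|x y /isIntegralP Ix /isIntegralP Iy|x y /isIntegralP Ix /isIntegralP Iy].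
- by apply/isIntegralP/integral1.
- by apply/isIntegralP/integral_sub.
- by apply/isIntegralP/integral_mul.
Qed.

HB.instance Definition _ := GRing.isSubringClosed.Build K isIntegral
  isIntegral_subring.

Record ringOfIntegers :=
  RingOfIntegers { intval : K; intvalP : intval \in isIntegral }.

HB.instance Definition _ := [isSub for intval].
HB.instance Definition _ := [Choice of ringOfIntegers by <:].
HB.instance Definition _ := [SubChoice_isSubComNzRing of ringOfIntegers by <:].

Definition int_unit : pred ringOfIntegers :=
  fun x => `[< exists y, y * x = 1 >].

Definition int_inv (x : ringOfIntegers) : ringOfIntegers :=
  xget x [set y | y * x = 1].

Lemma int_mulVx : {in int_unit, left_inverse 1 int_inv *%R}.
Proof.
move=> x /asboolP [y yx1]; rewrite /int_inv.
by case: xgetP => [z _ //|/(_ y)].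
Qed.

Lemma int_unitPl (x y : ringOfIntegers) : y * x = 1 -> int_unit x.
Proof. by move=> yx1; apply/asboolP; exists y. Qed.

Lemma int_inv_out : {in [predC int_unit], int_inv =1 id}.
Proof.
move=> x /asboolP nx; apply: xgetPN => y yx1; apply: nx.
by exists y.
Qed.

HB.instance Definition _ := GRing.ComNzRing_hasMulInverse.Build ringOfIntegers
  int_mulVx int_unitPl int_inv_out.

Lemma int_idomain (x y : ringOfIntegers) : x * y = 0 -> (x == 0) || (y == 0).
Proof.
move=> /(congr1 intval) xy0; rewrite -!(inj_eq val_inj) /= -mulf_eq0.
exact/eqP.
Qed.

HB.instance Definition _ :=
  GRing.ComUnitRing_isIntegral.Build ringOfIntegers int_idomain.

End RingOfIntegers.

Section Ideals.
Variable R : comNzRingType.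

Definition ideal_mul (I J : set R) : set R :=
  [set x | exists n (a b : 'I_n -> R),
     [/\ forall i, I (a i), forall i, J (b i) & x = \sum_(i < n) a i * b i]].

Definition ideal_exp (I : set R) (n : nat) : set R :=
  iter n (ideal_mul I) setT.

Definition nonzero_ideal (I : set R) : Prop := exists2 x, I x & x != 0.

Definition principal (a : R) : {pred R} := fun x => `[< exists y, x = a * y >].

Lemma principal_zmod (a : R) : zmod_closed (principal a).
Proof.
split=> [|x y /asboolP [u ->] /asboolP [v ->]]; apply/asboolP.
  by exists 0; rewrite mulr0.
by exists (u - v); rewrite mulrBr.
Qed.

HB.instance Definition _ (a : R) := GRing.isZmodClosed.Build R (principal a)
  (principal_zmod a).

(* R / mR; only its additive group is used, since the library's ring structure
   on {ideal_quot I} would require a proof that I is proper. *)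
Local Notation quot_nat m := {ideal_quot (principal (m%:R : R))}.

Definition induced (m : nat) (A : R -> R) (c : quot_nat m) : quot_nat m :=
  lift_op1 (quot_nat m) A c.

Lemma induced_pi (m : nat) (A : {additive R -> R}) (x : R) :
  induced A (\pi_(quot_nat m) x) = \pi_(quot_nat m) (A x).
Proof.
rewrite /induced; unlock; apply/eqP; rewrite -Quotient.idealrBE -raddfB.
have : repr (\pi_(quot_nat m) x) - x \in principal m%:R.
  by rewrite Quotient.idealrBE reprK.
move=> /asboolP [y ->]; apply/asboolP; exists (A y).
by rewrite !mulr_natl raddfMn.
Qed.

Lemma induced_zmod_morphism (m : nat) (A : {additive R -> R}) :
  zmod_morphism (@induced m A).
Proof.
move=> c d; rewrite -[c]reprK -[d]reprK -raddfB !induced_pi.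
by rewrite -raddfB -raddfB.
Qed.

Lemma induced_bij (m : nat) (A : {additive R -> R}) :
  bijective A -> bijective (@induced m A).
Proof.
case=> B AK BK.
have Badd : zmod_morphism B.
  by move=> x y; apply: (can_inj AK); rewrite raddfB !BK.
pose B' : {additive R -> R} :=
  HB.pack B (GRing.isZmodMorphism.Build R R B Badd).
exists (@induced m B') => c; rewrite -[c]reprK !induced_pi /=.
  by rewrite AK.
by rewrite BK.
Qed.

End Ideals.

Section KFree.
Variables (K : fieldExtType rat) (k : nat).
Local Notation OK := (ringOfIntegers K).
Local Notation quot_nat m := {ideal_quot (principal (m%:R : OK))}.

Definition kfree : set OK :=
  [set x | forall P : prime_idealr OK, nonzero_ideal [set` P] ->
     ~ ideal_exp [set` P] k x].

(* P divides p when it contains p. *)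
Definition kfree_loc (p : nat) : set (quot_nat (p ^ k)) :=
  [set \pi_(quot_nat (p ^ k)) x | x in
     [set x : OK | forall P : prime_idealr OK, nonzero_ideal [set` P] ->
        p%:R \in P -> ~ ideal_exp [set` P] k x]].

End KFree.

Arguments kfree : clear implicits.
Arguments kfree_loc : clear implicits.

(* Main.v *)
(* If A preserves the k-free integers, then for each prime P over a large rational
   prime l the image A(P^k) lies in the union of the primes over l: otherwise some
   A(x), x in P^k, is k-free at l, and by a sieve the class A(x) + l^k O contains a
   k-free integer, although its preimage lies in P^k.  When P has degree one and is
   unramified, P = P^k + l O, so A(P) is covered by the primes over l as well.
   Every x is congruent to an integer c modulo such a P, hence x - c and x^2 - c^2
   lie in P; as there are at most [K : Q] primes over l, one of them contains both
   A(x - c) and A(x^2 - c^2), hence also A(x^2) A(1) - A(x)^2.  There are infinitely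
   many such l, so A(x^2) A(1) = A(x)^2.  Polarizing, A / A(1) is multiplicative and
   extends to an automorphism tau of K; surjectivity of A makes A(1) a unit. *)

Require Import Defs.
From HB Require Import structures.
From mathcomp Require Import all_boot all_order all_algebra all_field.
From mathcomp Require Import boolp classical_sets.
From mathcomp Require Import perm ring lra zify.

Set Implicit Arguments.
Unset Strict Implicit.
Unset Printing Implicit Defensive.

Import Order.TTheory GRing.Theory Num.Theory.
Local Open Scope ring_scope.
Local Open Scope classical_set_scope.

(** * Integral elements and the regular representation *)

(** The hypothesis on [A] speaks of all primes at once; isolating one of them requires k-free
    integers in every class modulo [l^k] that is k-free at [l]. The obstacle there is the large
    primes. In a box of side [N] in [Z[theta]], with [n] the degree, the primes over [l] spoil
    [O(N^n / l^2 + 1)] points. The terms 1 are harmless because norms in the box are [O(N^n)] while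
    a nonzero element of [P^2] has norm at least [l^2], so only [O(N^(n/2))] values of [l] occur.
    The norm bound is established for unramified primes; small [l], which include the exceptional
    ones, are handled by a congruence instead. Primes are reached through [Z[theta]] for an integral
    primitive element [theta]: away from the index and from the norm of the derivative at [theta],
    polynomials modulo [l] describe them. Finally (c) gives (b) because an automorphism permutes the
    primes over [p], and (b) gives (a) because being k-free is the conjunction of the conditions at
    all [p]. *)

Section RegularRepresentation.
Variables (K : fieldExtType rat) (m : nat) (e : m.+1.-tuple K).
Hypothesis eB : basis_of {:K} e.

Definition vec (a : 'rV[rat]_m.+1) : K := \sum_i a 0 i *: e`_i.

Lemma vec_coord (x : K) : vec (\row_i coord e i x) = x.
Proof.
rewrite [RHS](coord_basis eB (memvf x)).
by apply: eq_bigr => i _; rewrite mxE.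
Qed.

Lemma vec_inj : injective vec.
Proof.
move=> a b eqab; apply/rowP=> i; apply/eqP; rewrite -subr_eq0; apply/eqP.
move/freeP: (basis_free eB) => /(_ (fun i => a 0 i - b 0 i)); apply.
transitivity (vec a - vec b); last by rewrite eqab subrr.
by rewrite /vec -sumrB; apply: eq_bigr => j _; rewrite scalerBl.
Qed.

Definition mulmat (x : K) : 'M[rat]_m.+1 :=
  \matrix_(i, j) coord e j (e`_i * x).

Lemma vec_mulmat a x : vec (a *m mulmat x) = vec a * x.
Proof.
rewrite /vec mulr_suml; under eq_bigr do rewrite mxE scaler_suml.
rewrite exchange_big; apply: eq_bigr => i _ /=.
rewrite -scalerAl [in RHS](coord_basis eB (memvf (e`_i * x))) scaler_sumr.
by apply: eq_bigr => j _; rewrite mxE scalerA.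
Qed.

Lemma mulmat_eq x M : (forall a, vec (a *m M) = vec a * x) -> mulmat x = M.
Proof.
move=> xM; apply/row_matrixP=> i; rewrite !rowE; apply: vec_inj.
by rewrite vec_mulmat xM.
Qed.

Lemma vecD a b : vec (a + b) = vec a + vec b.
Proof. by rewrite /vec -big_split; apply: eq_bigr => i _; rewrite mxE scalerDl. Qed.

Lemma vecZ c a : vec (c *: a) = c *: vec a.
Proof. by rewrite /vec scaler_sumr; apply: eq_bigr => i _; rewrite mxE scalerA. Qed.

Lemma mulmatD x y : mulmat (x + y) = mulmat x + mulmat y.
Proof. by apply: mulmat_eq => a; rewrite mulmxDr vecD !vec_mulmat mulrDr. Qed.

Lemma mulmatZ c x : mulmat (c *: x) = c *: mulmat x.
Proof. by apply: mulmat_eq => a; rewrite -scalemxAr vecZ vec_mulmat scalerAr. Qed.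

Lemma mulmatM x y : mulmat (x * y) = mulmat x *m mulmat y.
Proof. by apply: mulmat_eq => a; rewrite mulmxA !vec_mulmat mulrA. Qed.

Lemma mulmat1 : mulmat 1 = 1%:M.
Proof. by apply: mulmat_eq => a; rewrite mulmx1 mulr1. Qed.

Lemma mulmat0 : mulmat 0 = 0.
Proof. by have := mulmatZ 0 0; rewrite !scale0r. Qed.

Lemma mulmat_sum I (r : seq I) (F : I -> K) :
  mulmat (\sum_(i <- r) F i) = \sum_(i <- r) mulmat (F i).
Proof. exact: (big_morph mulmat mulmatD mulmat0). Qed.

Lemma mulmat_inj : injective mulmat.
Proof.
move=> x y xy; have := vec_mulmat (\row_i coord e i 1) x.
by rewrite xy vec_mulmat !vec_coord !mul1r.
Qed.

Lemma horner_mulmat x (p : {poly rat}) :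
  horner_mx (mulmat x) p = mulmat (map_poly (in_alg K) p).[x].
Proof.
elim/poly_ind: p => [|p c IHp]; first by rewrite map_poly0 horner0 mulmat0 rmorph0.
rewrite !rmorphD !rmorphM /= horner_mx_X horner_mx_C map_polyX map_polyC /=.
by rewrite !hornerE mulmatD mulmatM IHp mulmatZ mulmat1 scalemx1.
Qed.

Lemma det_mulmat_neq0 x : x != 0 -> \det (mulmat x) != 0.
Proof.
move=> x0; apply/eqP=> d0; have := congr1 determinant (mulmatM x x^-1).
by rewrite divff // det_mulmx d0 mul0r mulmat1 det1 => /eqP; rewrite oner_eq0.
Qed.

Lemma map_intr_comp (p : {poly int}) :
  map_poly (intr : int -> K) p = map_poly (in_alg K) (map_poly intr p).
Proof. by rewrite -map_poly_comp; apply: eq_map_poly => c /=;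
  rewrite alg_num_field ratr_int. Qed.

Lemma char_poly_mulmat x :
  (map_poly (in_alg K) (char_poly (mulmat x))).[x] = 0.
Proof.
apply: mulmat_inj; rewrite -horner_mulmat mulmat0.
exact: Cayley_Hamilton.
Qed.

(* The eigenvalues of the regular representation of an integral element are
   algebraic integers, so its rational characteristic polynomial is integral. *)
Lemma char_poly_int x : x \in @isIntegral K ->
  {q : {poly int} | q \is monic & map_poly intr q = char_poly (mulmat x)}.
Proof.
move=> /isIntegralP Ix; apply: cid2; case: Ix => p pm px.
set A := mulmat x.
have pA : horner_mx A (map_poly intr p) = 0.
  by rewrite horner_mulmat -map_intr_comp (rootP px) mulmat0.
pose AC : 'M[algC]_m.+1 := map_mx ratr A.
have cAC : map_poly ratr (char_poly A) = char_poly AC by rewrite map_char_poly.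
have AintC : char_poly AC \is a polyOver Aint.
  have [r Dr] := closed_field_poly_normal (char_poly AC).
  rewrite Dr (monicP (char_poly_monic _)) scale1r big_seq rpred_prod // => z zr.
  rewrite polyOverXsubC; apply: (@root_monic_Aint (map_poly intr p)).
  (* The eigenvalues are roots of the minimal polynomial, which divides the monic integral [p]. *)
  - have /dvdpP[u Du] : mxminpoly AC %| map_poly intr p.
      apply: mxminpoly_min.
      have := congr1 (map_mx (ratr : rat -> algC)) pA.
      rewrite map_horner_mx map_mx0 -map_poly_comp /= => <-; congr horner_mx.
      by apply: eq_map_poly => c /=; rewrite ratr_int.
    rewrite Du rootM -eigenvalue_root_min eigenvalue_root_char Dr.
    by rewrite (monicP (char_poly_monic _)) scale1r root_prod_XsubC zr orbT.
  - by rewrite monic_map.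
  - by apply/polyOverP=> i; rewrite coef_map /= intr_int.
have /floorpP[q Dq] : char_poly AC \is a polyOver Num.int.
  apply/polyOverP => i; apply: Cint_rat_Aint; last exact: (polyOverP AintC).
  by rewrite -cAC coef_map /= Crat_rat.
have qA : map_poly intr q = char_poly A.
  apply: (@map_poly_inj _ _ (ratr : rat -> algC)).
  rewrite -map_poly_comp /= cAC Dq; apply: eq_map_poly => c /=; exact: ratr_int.
exists q => //; have := char_poly_monic A; rewrite -qA !monicE.
rewrite lead_coef_map_inj //; last exact: intr_inj.
by rewrite -[in X in X -> _](mulr1z 1) eqr_int.
Qed.

End RegularRepresentation.

Lemma clear_denominators (I : finType) (k : I -> rat) :
  exists2 D : int, D != 0 & forall i, D%:~R * k i \is a Num.int.
Proof.
exists (\prod_i denq (k i)); first by apply/prodf_neq0 => i _; rewrite denq_neq0.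
move=> i; rewrite (bigD1 i) //= -[X in _ * X]divq_num_den rmorphM /=.
have clear_den (F : fieldType) (d r s : F) : d != 0 -> d * r * (s / d) = s * r.
  by move=> d0; field.
by rewrite clear_den ?intr_eq0 ?denq_neq0 // -rmorphM intr_int.
Qed.

(** * Denominators and integral power bases *)

Section IntegerTheory.
Variable K : fieldExtType rat.
Local Notation OK := (ringOfIntegers K).

HB.instance Definition _ := GRing.RMorphism.copy (@intval K) (\val : OK -> K).

Lemma intval_inj : injective (@intval K).
Proof. exact: val_inj. Qed.

Definition zeval (a : {poly int}) (x : OK) : OK := (map_poly intr a).[x].

Lemma intval_zeval a x : intval (zeval a x) = (map_poly intr a).[intval x].
Proof.
rewrite /zeval -horner_map -map_poly_comp; congr _.[_].
by apply: eq_map_poly => c /=; rewrite rmorph_int.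
Qed.

Lemma zevalD a b x : zeval (a + b) x = zeval a x + zeval b x.
Proof. by rewrite /zeval rmorphD hornerD. Qed.

Lemma zevalM a b x : zeval (a * b) x = zeval a x * zeval b x.
Proof. by rewrite /zeval rmorphM hornerM. Qed.

Lemma zevalC c x : zeval c%:P x = c%:~R.
Proof. by rewrite /zeval map_polyC hornerC. Qed.

Lemma zevalX x : zeval 'X x = x.
Proof. by rewrite /zeval map_polyX hornerX. Qed.

Lemma intr_OK_eq0 (c : int) : (c%:~R == 0 :> OK) = (c == 0).
Proof.
rewrite -(inj_eq intval_inj) rmorph_int rmorph0.
apply/eqP/eqP => [c0|-> //]; have : (c%:~R%:A : K) == 0.
  by rewrite alg_num_field ratr_int c0.
by rewrite scaler_eq0 oner_eq0 orbF intr_eq0 => /eqP.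
Qed.

(** Clearing the denominators of the matrix of [x] makes [c * x] act by an integer matrix, whose
    characteristic polynomial is monic, integral and kills [c * x]. *)
Lemma integral_scale (x : K) :
  exists2 c : int, c != 0 & exists y : OK, intval y = c%:~R * x.
Proof.
have [m [e eB]] : exists m (e : m.+1.-tuple K), basis_of {:K} e.
  have : \dim {:K} = (\dim {:K}).-1.+1 by rewrite prednK // adim_gt0.
  move: (vbasis _) (vbasisP {:K}) => e + Dn; rewrite Dn in e * => eB.
  by exists (\dim {:K}).-1, e.
set A := mulmat e x.
have [c c0 cA2] := clear_denominators (fun ij => A ij.1 ij.2).
have cA i j : c%:~R * A i j \is a Num.int by exact: (cA2 (i, j)).
exists c => //.
pose B : 'M[int]_m.+1 := \matrix_(i, j) numq (c%:~R * A i j).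
have DB : mulmat e (c%:~R * x) = map_mx intr B.
  rewrite -[c%:~R](ratr_int _ c) -alg_num_field mulr_algl (mulmatZ eB).
  apply/matrixP => i j; rewrite !mxE -/A.
  have /intrP[z Dz] := cA i j; move: Dz; rewrite mxE => ->.
  by rewrite numq_int.
suff I : c%:~R * x \in @isIntegral K by exists (RingOfIntegers I).
apply/isIntegralP; exists (char_poly B); first exact: char_poly_monic.
have := char_poly_mulmat eB (c%:~R * x).
by rewrite DB -map_char_poly -map_intr_comp => /eqP.
Qed.

(** A primitive element [g] exists in characteristic zero. Scaling it to an integral [t = c * g]
    changes its powers only by nonzero rational factors. *)
Lemma integral_power_basis : exists m (theta : OK),
  basis_of {:K} [tuple intval theta ^+ i | i < m.+1].
Proof.
pose g := separable_generator 1 {:K}.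
have Dg : ({:K} = <<1; g>>)%VS.
  apply: eq_adjoin_separable_generator; last exact: sub1v.
  apply/separableP => y _; apply: pcharf0_separable => p.
  by rewrite (pchar_lalg K) pchar_num.
have [c c0 [t Dt]] := integral_scale g.
have Dn : \dim {:K} = (\dim {:K}).-1.+1 by rewrite prednK // adim_gt0.
have cK0 : (c%:~R : K) != 0.
  by rewrite -(rmorph_int (@intval K)) -(rmorph0 (@intval K)) (inj_eq intval_inj)
    intr_OK_eq0.
exists (\dim {:K}).-1, t; rewrite basisEdim; apply/andP; split;
  last by rewrite size_tuple -Dn.
apply/subvP => v; rewrite {1}Dg => /Fadjoin_poly_eq <-.
set p := Fadjoin_poly _ _ _.
have sp : (size p <= (\dim {:K}).-1.+1)%N.
  have := size_Fadjoin_poly 1 g v; rewrite adjoin_degreeE dimv1 divn1 -Dg -Dn.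
  exact.
rewrite (horner_coef_wide _ sp); apply: memv_suml => i _.
have /polyOverP/(_ i)/vlineP[a ->] : p \is a polyOver 1%AS.
  exact: Fadjoin_polyOver.
rewrite mulr_algl memvZ //.
have -> : g = (c%:~R)^-1 * intval t by rewrite Dt mulKf.
rewrite exprMn -(rmorph_int (in_alg K)) -fmorphV -rmorphXn /= mulr_algl memvZ //.
apply: memv_span; apply/mapP; exists i => //; exact: mem_enum.
Qed.

End IntegerTheory.

(** Leibniz expansion. For multiplication matrices it bounds the norm by a power of the box side
    whose exponent is the degree. *)
Lemma det_bound (R : realDomainType) n (A : 'M[R]_n) (c : R) :
  (forall i j, `|A i j| <= c) -> `|\det A| <= n`!%:R * c ^+ n.
Proof.
move=> Ac; apply: (le_trans (ler_norm_sum _ _ _)).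
have -> : n`!%:R * c ^+ n = \sum_(s : 'S_n) c ^+ n.
  by rewrite sumr_const card_Sn mulr_natl.
apply: ler_sum => s _; rewrite normrM normr_sign mul1r normr_prod.
rewrite -[X in _ ^+ X]card_ord -prodr_const; apply: ler_prod => i _.
by rewrite normr_ge0 Ac.
Qed.

Lemma ler_sum_entry (R : realDomainType) (I J : finType) (F : I -> J -> R) i j :
  (forall i j, 0 <= F i j) -> F i j <= \sum_i \sum_j F i j.
Proof.
move=> F0; apply: (@le_trans _ _ (\sum_j F i j)).
  by rewrite (bigD1 j) //= lerDl sumr_ge0.
by rewrite [leRHS](bigD1 i) //= lerDl; do 2!apply: sumr_ge0 => ? _.
Qed.

Definition power_basis (K : fieldExtType rat) m (theta : ringOfIntegers K) :
  m.+1.-tuple K := [tuple intval theta ^+ i | i < m.+1].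

(** * Norm, trace and index of a power basis *)

Section PowerBasis.
Variables (K : fieldExtType rat) (m : nat) (theta : ringOfIntegers K).
Local Notation OK := (ringOfIntegers K).
Local Notation e := (power_basis m theta).
Hypothesis eB : basis_of {:K} e.

Lemma power_basisE (i : 'I_m.+1) : e`_i = intval (theta ^+ i).
Proof. by rewrite -tnth_nth tnth_mktuple rmorphXn. Qed.

(** The determinant is an integer for integral [z], so [numq] loses nothing; see [normE]. *)
Definition norm (z : OK) : int := numq (\det (mulmat e (intval z))).

Lemma normE z : (norm z)%:~R = \det (mulmat e (intval z)).
Proof.
have [q _ qE] := char_poly_int eB (intvalP z).
have := char_poly_det (mulmat e (intval z)); rewrite -qE coef_map /= => qdet.
suff : \det (mulmat e (intval z)) \is a Num.int.
  by case/intrP => t; rewrite /norm => ->; rewrite numq_int.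
by rewrite -[\det _](signrMK m.+1) -qdet rpredM ?rpredX ?rpredN ?intr_int.
Qed.

(** The norm is, up to sign, the constant term of the characteristic polynomial [q]. Since [q]
    vanishes at [z], that term is [z] times a polynomial in [z]. *)
Lemma norm_dvd z : exists z', z * z' = (norm z)%:~R.
Proof.
have [q _ qE] := char_poly_int eB (intvalP z).
have qz : zeval q z = 0.
  apply: intval_inj; rewrite intval_zeval map_intr_comp qE.
  exact: char_poly_mulmat.
have Nq : (norm z)%:~R = (-1) ^+ m.+1 * (q`_0)%:~R :> OK.
  have -> : norm z = (-1) ^+ m.+1 * q`_0; last by rewrite rmorphM rmorph_sign.
  apply: (@intr_inj rat); rewrite normE rmorphM rmorph_sign /=.
  by rewrite -coef_map /= qE char_poly_det signrMK.
have [r Dq] : exists r, q = r * 'X + (q`_0)%:P.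
  have /factor_theorem[r Dr] : root (q - (q`_0)%:P) 0.
    by rewrite /root !hornerE horner_coef0 subrr.
  by exists r; rewrite -[LHS](subrK (q`_0)%:P) Dr subr0.
exists (- (-1) ^+ m.+1 * zeval r z).
move: qz; rewrite Dq zevalD zevalM zevalX zevalC => /eqP.
rewrite Nq addr_eq0 => /eqP; rewrite mulrCA [z * _]mulrC => ->.
by rewrite mulNr mulrN opprK.
Qed.

Lemma norm_neq0 z : z != 0 -> norm z != 0.
Proof.
move=> z0; rewrite -(intr_eq0 rat) normE det_mulmat_neq0 //.
Qed.

Definition comb (y : 'I_m.+1 -> int) : OK := \sum_i (y i)%:~R * theta ^+ i.

Lemma comb_vec y : intval (comb y) = vec e (\row_i (y i)%:~R).
Proof.
rewrite /comb /vec rmorph_sum; apply: eq_bigr => i _.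
by rewrite rmorphM rmorph_int mxE power_basisE -(rmorph_int (in_alg K)) mulr_algl.
Qed.

Lemma comb_eq0 y : comb y = 0 -> forall i, y i = 0.
Proof.
move=> /(congr1 (@intval K)); rewrite comb_vec rmorph0 => y0 i.
have /rowP/(_ i) : \row_i (y i)%:~R = 0 :> 'rV[rat]_m.+1.
  apply: (vec_inj eB); rewrite y0 /vec big1 // => j _.
  by rewrite mxE scale0r.
by rewrite !mxE => /eqP; rewrite intr_eq0 => /eqP.
Qed.

Lemma combB y y' : comb y - comb y' = comb (fun i => y i - y' i).
Proof.
by rewrite /comb -sumrB; apply: eq_bigr => i _; rewrite rmorphB mulrBl.
Qed.

(** The matrix of [c + M * comb y] is affine in [y], so its entries are at most [B * N]; [0 < N]
    lets the constant part be absorbed. Then [det_bound] applies. *)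
Lemma norm_bound (c : OK) (M : nat) : exists C : nat, forall (N : nat) y,
    (0 < N)%N -> (forall i, `|y i| <= N%:R) ->
  `|norm (c + M%:R * comb y)| <= (C * N ^ m.+1)%:R.
Proof.
pose A0 := mulmat e (intval c);
  pose A (i : 'I_m.+1) := mulmat e (intval (theta ^+ i)).
pose B : rat := \sum_i \sum_j (`|A0 i j| + \sum_k `|M%:R * A k i j|).
have B0 : 0 <= B.
  by do 2!apply: sumr_ge0 => ? _; rewrite addr_ge0 ?sumr_ge0.
have B_le i j : `|A0 i j| + \sum_(k < m.+1) `|M%:R * A k i j| <= B.
  apply: (@ler_sum_entry _ _ _ (fun i j => `|A0 i j| + \sum_k `|M%:R * A k i j|)).
  by move=> ? ?; rewrite addr_ge0 ?sumr_ge0.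
pose C := (m.+1)`!%:R * B ^+ m.+1.
exists (Num.truncn C).+1 => N y N_gt0 yN.
rewrite -(ler_int rat) intr_norm normE natz -pmulrn natrM natrX.
set A1 := mulmat _ _.
have A1E : A1 = A0 + \sum_i (M%:R * (y i)%:~R) *: A i.
  rewrite /A1 rmorphD rmorphM rmorph_nat (mulmatD eB); congr (_ + _).
  rewrite /comb rmorph_sum mulr_sumr (mulmat_sum eB); apply: eq_bigr => i _.
  rewrite -(mulmatZ eB) rmorphM rmorph_int mulrA -[in RHS]mulr_algl.
  by rewrite -in_algE rmorphM rmorph_nat rmorph_int.
have A1_le i j : `|A1 i j| <= B * N%:R.
  rewrite A1E mxE summxE; apply: (le_trans (ler_normD _ _)).
  apply: (@le_trans _ _ ((`|A0 i j| + \sum_(k < m.+1) `|M%:R * A k i j|) * N%:R)).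
    rewrite mulrDl; apply: lerD; first by rewrite ler_peMr // ler1n.
    rewrite mulr_suml; apply: (le_trans (ler_norm_sum _ _ _)).
    apply: ler_sum => k _; rewrite mxE mulrAC normrM; apply: ler_wpM2l => //.
    by rewrite -intr_norm -[N%:R]/(N%:Z%:~R) ler_int -[N%:Z]natz yN.
  by rewrite ler_wpM2r.
apply: (le_trans (det_bound A1_le)); rewrite exprMn mulrA.
rewrite ler_wpM2r ?exprn_ge0 //.
exact/ltW/truncnS_gt.
Qed.

Definition trace (x : K) : rat := \tr (mulmat e x).

Lemma trace_int (x : OK) : trace (intval x) \is a Num.int.
Proof.
have [q _ qE] := char_poly_int eB (intvalP x).
have := char_poly_trace (mulmat e (intval x)) isT; rewrite -qE coef_map /= => qtr.
by rewrite /trace -[\tr _]opprK -qtr rpredN intr_int.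
Qed.

Lemma trace_sum I (r : seq I) (c : I -> rat) (F : I -> K) :
  trace (\sum_(i <- r) c i *: F i) = \sum_(i <- r) c i * trace (F i).
Proof.
rewrite /trace (mulmat_sum eB) raddf_sum; apply: eq_bigr => i _ /=.
by rewrite (mulmatZ eB) mxtraceZ.
Qed.

Lemma vecE a : vec e a = \sum_i a 0 i *: intval (theta ^+ i).
Proof. by apply: eq_bigr => i _; rewrite power_basisE. Qed.

(* The trace form is nondegenerate, so its Gram determinant bounds the index of
   [Z[theta]] in the ring of integers. *)
Lemma power_basis_index : exists2 D : int, D != 0 &
  forall x : OK, exists y, D%:~R * x = comb y.
Proof.
pose tf (i j : 'I_m.+1) := trace (intval (theta ^+ i * theta ^+ j)).
pose G : 'M[int]_m.+1 := \matrix_(i, j) numq (tf i j).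
have GE i j : (G i j)%:~R = tf i j.
  by rewrite mxE numqK ?trace_int.
have vecG a j : (a *m map_mx intr G) 0 j = trace (vec e a * intval (theta ^+ j)).
  rewrite mxE vecE mulr_suml; under [in RHS]eq_bigr do rewrite -scalerAl.
  by rewrite trace_sum; apply: eq_bigr => i _; rewrite mxE GE /tf rmorphM.
exists (\det G) => [|x].
  apply/negP => /eqP detG0.
  have /det0P[a a0 aG] : \det (map_mx (intr : int -> rat) G) == 0.
    by rewrite det_map_mx /= detG0.
  have va0 : vec e a != 0.
    apply: contra_neq a0 => va0; apply: (vec_inj eB); rewrite va0 /vec big1 // => i _.
    by rewrite mxE scale0r.
  have tr0 y : trace (vec e a * y) = 0.
    rewrite -(vec_coord eB y) (vecE (\row_i _)) mulr_sumr.
    under eq_bigr do rewrite -scalerAr.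
    by rewrite trace_sum big1 // => j _; rewrite -vecG aG !mxE mulr0.
  (* Pairing with the inverse gives the trace of 1, which is the degree and hence nonzero. *)
  have := tr0 (vec e a)^-1; rewrite divff // /trace (mulmat1 eB) mxtrace1 => /eqP.
  by rewrite pnatr_eq0.
pose a := \row_i coord e i (intval x).
pose t : 'rV[int]_m.+1 := \row_j numq (trace (intval (x * theta ^+ j))).
have aG : a *m map_mx intr G = map_mx intr t.
  apply/rowP=> j; rewrite vecG (vec_coord eB) !mxE -rmorphM.
  by rewrite numqK ?trace_int.
exists (fun i => (t *m \adj G) 0 i).
apply: intval_inj; rewrite comb_vec rmorphM rmorph_int /= -[intval x](vec_coord eB)
  -/a.
rewrite -(rmorph_int (in_alg K)) mulr_algl -(vecZ e); congr vec.
(* Cramer's rule: the adjugate solves the system for the coordinates of [x] with denominator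
   [\det G]. *)
have /rowP aGG : (\det G)%:~R *: a = map_mx intr (t *m \adj G).
  rewrite map_mxM -aG -mulmxA -map_mxM mul_mx_adj map_scalar_mx.
  by rewrite mul_mx_scalar.
by apply/rowP => i; rewrite aGG !mxE.
Qed.

Lemma zeval_comb (a : {poly int}) :
  (size a <= m.+1)%N -> zeval a theta = comb (fun i => a`_i).
Proof.
move=> sa; rewrite /zeval (horner_coef_wide theta (n := m.+1)).
  by apply: eq_bigr => i _; rewrite coef_map.
exact: leq_trans (size_poly _ _) sa.
Qed.

Lemma zeval_eq0 (a : {poly int}) :
  (size a <= m.+1)%N -> zeval a theta = 0 -> a = 0.
Proof.
move=> sa; rewrite zeval_comb // => /comb_eq0 a0; apply/polyP => i; rewrite coef0.
have [im|mi] := ltnP i m.+1; first exact: (a0 (Ordinal im)).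
by rewrite nth_default // (leq_trans sa).
Qed.

Lemma power_basis_poly : exists f : {poly int},
  [/\ f \is monic, size f = m.+2 & zeval f theta = 0].
Proof.
have [f fm fE] := char_poly_int eB (intvalP theta); exists f; split => //.
  rewrite -(size_map_inj_poly (@intr_inj rat)) //.
  by rewrite fE size_char_poly.
apply: intval_inj; rewrite intval_zeval map_intr_comp fE.
exact: char_poly_mulmat.
Qed.

Lemma comb_zeval y : exists a, comb y = zeval a theta.
Proof.
exists (\poly_(i < m.+1) y (inord i)); rewrite zeval_comb ?size_poly //.
by apply: eq_bigr => i _; rewrite coef_poly ltn_ord inord_val.
Qed.

End PowerBasis.

(** * Prime ideals and their powers *)

Section IdealPowers.
Variable R : comNzRingType.
Implicit Types (I J : set R) (P : prime_idealr R).

Lemma ideal_mul_ind I J (Q : R -> Prop) :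
    (forall a b, I a -> J b -> Q (a * b)) -> Q 0 ->
    (forall x y, Q x -> Q y -> Q (x + y)) ->
  forall x, ideal_mul I J x -> Q x.
Proof.
move=> QM Q0 QD x [n [a [b [Ia Jb ->]]]].
by apply: (big_ind Q) => // i _; apply: QM.
Qed.

Lemma ideal_mulD I J x y :
  ideal_mul I J x -> ideal_mul I J y -> ideal_mul I J (x + y).
Proof.
move=> [n [a [b [Ia Jb ->]]]] [n' [a' [b' [Ia' Jb' ->]]]].
exists (n + n')%N.
exists (fun i => match fintype.split i with inl j => a j | inr j => a' j end).
exists (fun i => match fintype.split i with inl j => b j | inr j => b' j end).
split; [by move=> i; case: fintype.split | by move=> i; case: fintype.split |].
rewrite big_split_ord; congr (_ + _); apply: eq_bigr => i _.
  by rewrite (unsplitK (inl i)).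
by rewrite (unsplitK (inr i)).
Qed.

Lemma ideal_mul_prod I J a b : I a -> J b -> ideal_mul I J (a * b).
Proof.
by move=> Ia Jb; exists 1%N, (fun=> a), (fun=> b); split=> //; rewrite big_ord1.
Qed.

Lemma ideal_mulMl I J c x : (forall a, I a -> I (c * a)) ->
  ideal_mul I J x -> ideal_mul I J (c * x).
Proof.
move=> Ic [n [a [b [Ia Jb ->]]]].
exists n, (fun i => c * a i), b; split=> // [i|]; first exact: Ic.
by rewrite mulr_sumr; apply: eq_bigr => i _; rewrite mulrA.
Qed.

Lemma ideal_expD P k x y :
  ideal_exp [set` P] k x -> ideal_exp [set` P] k y ->
  ideal_exp [set` P] k (x + y).
Proof. by case: k => // k; apply: ideal_mulD. Qed.

Lemma ideal_expMl P k c x :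
  ideal_exp [set` P] k x -> ideal_exp [set` P] k (c * x).
Proof. by case: k => // k; apply: ideal_mulMl => a; apply: idealMr. Qed.

Lemma ideal_expB P k x y :
  ideal_exp [set` P] k x -> ideal_exp [set` P] k y ->
  ideal_exp [set` P] k (x - y).
Proof. by move=> Px Py; rewrite -mulN1r; apply/ideal_expD/ideal_expMl. Qed.

Lemma ideal_exp0 P k : ideal_exp [set` P] k 0.
Proof.
by case: k => // k; exists 0%N, (fun=> 0), (fun=> 0); split=> [[]|[]|] //;
  rewrite big_ord0.
Qed.

Lemma ideal_expS_sub P k x :
  ideal_exp [set` P] k.+1 x -> ideal_exp [set` P] k x.
Proof.
apply: ideal_mul_ind => [a b _||]; [exact: ideal_expMl|exact: ideal_exp0|].
exact: ideal_expD.
Qed.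

Lemma ideal_exp_sub P j k x : (j <= k)%N ->
  ideal_exp [set` P] k x -> ideal_exp [set` P] j x.
Proof.
by elim: k => [|k IHk]; rewrite leq_eqVlt => /predU1P[->|] // /IHk jk /ideal_expS_sub.
Qed.

Lemma ideal_exp_mem P k x : (0 < k)%N -> ideal_exp [set` P] k x -> x \in P.
Proof.
move=> k0 /(ideal_exp_sub k0); apply: (@ideal_mul_ind [set` P] setT (fun x =>
  x \in P)) => [a b Pa _|| u v].
- by rewrite mulrC idealMr.
- exact: rpred0.
- exact: rpredD.
Qed.

Lemma ideal_expX P k x a :
  x \in P -> a \in P -> ideal_exp [set` P] k.+1 (x * a ^+ k).
Proof.
move=> Px Pa; apply: ideal_mul_prod => //.
by elim: k => //= k; rewrite exprS; apply: ideal_mul_prod.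
Qed.

Lemma ideal_exp_self P k a : a \in P -> ideal_exp [set` P] k (a ^+ k).
Proof. by case: k => // k Pa; rewrite exprS; apply: ideal_expX. Qed.

(** With [h] outside [P] this replaces localization at [P]: membership in a power of [P] becomes
    divisibility by a power of [l]. *)
Lemma ideal_exp_clear P k h l : (forall x, x \in P -> exists y, h * x = l * y) ->
  forall z, ideal_exp [set` P] k z -> exists y, h ^+ k * z = l ^+ k * y.
Proof.
move=> hP; elim: k => [|k IHk] z; first by exists z.
apply: (@ideal_mul_ind [set` P] (ideal_exp [set` P] k)
  (fun z => exists y, h ^+ k.+1 * z = l ^+ k.+1 * y)) =>
    [a b /hP[y ya] /IHk[y' yb]||x x' [y yx] [y' yx']].
- by exists (y * y'); rewrite !exprS mulrACA ya yb; ring.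
- by exists 0; rewrite !mulr0.
- by exists (y + y'); rewrite !mulrDr yx yx'.
Qed.

(** The factor [eps] serves the unit in (c); the case [f = idfun] gives monotonicity in the
    prime. *)
Lemma ideal_exp_morph P P' (f : {rmorphism R -> R}) (eps : R) k x :
  (forall y, y \in P -> f y \in P') ->
  ideal_exp [set` P] k x -> ideal_exp [set` P'] k (eps * f x).
Proof.
move=> fP Px; apply: ideal_expMl; elim: k x Px => //= k IHk x.
apply: (@ideal_mul_ind [set` P] (ideal_exp [set` P] k)
  (fun x => ideal_exp [set` P'] k.+1 (f x))) => [a b Pa Pb||y z];
    rewrite ?rmorphM ?rmorph0 ?rmorphD.
- by apply: ideal_mul_prod; [apply: fP|apply: IHk].
- exact: (@ideal_exp0 P' k.+1).
- exact: (@ideal_expD P' k.+1).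
Qed.

End IdealPowers.

Section Primes.
Variables (K : fieldExtType rat) (m : nat) (theta : ringOfIntegers K).
Local Notation OK := (ringOfIntegers K).
Local Notation e := (power_basis m theta).
Hypothesis eB : basis_of {:K} e.
Implicit Types (P : prime_idealr OK) (l : nat).

Lemma prime_bezout l (c : int) : prime l -> ~~ (l %| c)%Z ->
  exists u v : int, u * c + v * l = 1.
Proof.
move=> lp lc; have : coprimez c l by rewrite coprimezE coprime_sym prime_coprime.
by move=> /coprimezP[[u v] /= uv]; exists u, v.
Qed.

Lemma mem_ideal_int P l (c : int) : prime l -> l%:R \in P ->
  (c%:~R \in P) = (l %| c)%Z.
Proof.
move=> lp Pl; apply/idP/idP => [Pc|/dvdzP[q ->]]; last first.
  by rewrite rmorphM idealMr.
apply: contraT => /(prime_bezout lp)[u [v uv]].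
have : 1 \in P by rewrite -(mulr1z 1) -uv rmorphD !rmorphM rpredD ?idealMr.
by rewrite idealr1.
Qed.

(** The norm of a nonzero element of [P] gives a positive integer in [P]; primality lets one split
    off its least prime factor repeatedly. *)
Lemma rational_prime_in P : nonzero_ideal [set` P] ->
  exists2 l, prime l & l%:R \in P.
Proof.
case=> z Pz z0; have [z' zz'] := norm_dvd eB z.
have : `|norm m theta z|%:R \in P.
  have : (norm m theta z)%:~R \in P by rewrite -zz' mulrC idealMr.
  by case: (norm m theta z) => n //; rewrite NegzE rmorphN rpredN.
have : (0 < `|norm m theta z|)%N by rewrite absz_gt0 (norm_neq0 eB).
elim/ltn_ind: `|norm m theta z|%N => n IHn n0 Pn.
have [n1|n1] := leqP n 1.
  have n_eq1 : n = 1%N by case: n n0 n1 {IHn Pn} => [|[]].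
  by rewrite n_eq1 idealr1 in Pn.
move: Pn; rewrite -(divnK (pdiv_dvd n)) natrM prime_idealrM => /orP[Pn|Pn].
  apply: IHn Pn; first by rewrite ltn_Pdiv ?prime_gt1 ?pdiv_prime.
  by rewrite divn_gt0 ?pdiv_gt0 // dvdn_leq ?pdiv_dvd.
by exists (pdiv n) => //; apply: pdiv_prime.
Qed.

End Primes.

(** * Counting the primes over a rational prime *)

Section PrimesOver.
Variables (K : fieldExtType rat) (m : nat) (theta : ringOfIntegers K).
Local Notation OK := (ringOfIntegers K).
Local Notation e := (power_basis m theta).
Hypothesis eB : basis_of {:K} e.
Implicit Types (P : prime_idealr OK) (l : nat).

Lemma prod_notin P (I : finType) (A : pred I) (F : I -> OK) :
  (forall i, A i -> F i \notin P) -> \prod_(i | A i) F i \notin P.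
Proof.
move=> FP; apply: (big_ind (fun x => x \notin P)) => //; first by rewrite idealr1.
by move=> x y xP yP; rewrite prime_idealrM negb_or xP.
Qed.

Lemma prod_in P (I : finType) (A : pred I) (F : I -> OK) i :
  A i -> F i \in P -> \prod_(i | A i) F i \in P.
Proof. by move=> Ai Fi; rewrite (bigD1 i) //= mulrC idealMr. Qed.

(* All coefficients of a relation are divisible by [l], and dividing them by [l]
   gives another relation, so they are divisible by every power of [l]. *)
Lemma prime_dual_relation l (I : finType) (P : I -> prime_idealr OK) (E : I -> OK) :
    prime l -> (forall i, l%:R \in P i) -> (forall i, E i \notin P i) ->
    (forall i j, i != j -> E j \in P i) ->
  forall c : I -> int, \sum_i (c i)%:~R * E i = 0 -> forall i, c i = 0.
Proof.
move=> lp Pl EP PE c c0 i.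
suff dvd N : forall c : I -> int, \sum_i (c i)%:~R * E i = 0 ->
    forall i, (l%:Z ^+ N %| c i)%Z.
  apply/eqP; apply: contraT => ci0; have := dvd `|c i|.+1 c c0 i.
  rewrite dvdzE abszX absz_nat => /dvdn_leq; rewrite absz_gt0 => /(_ ci0).
  rewrite leqNgt (leq_trans (ltn_expl _ (prime_gt1 lp))) //.
  by rewrite leq_exp2l ?prime_gt1.
elim: N => [|N IHN] {i}c {}c0 i; first by rewrite expr0 dvd1z.
have ldvd j : (l %| c j)%Z.
  have : (c j)%:~R * E j \in P j.
    move: c0; rewrite (bigD1 j) //= => /eqP; rewrite addr_eq0 => /eqP ->.
    by rewrite rpredN rpred_sum // => k kj; rewrite idealMr // PE // eq_sym.
  by rewrite prime_idealrM (negPf (EP j)) orbF (mem_ideal_int _ lp).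
have lc j : c j = l%:Z * (c j %/ l)%Z by rewrite mulrC divzK.
rewrite (lc i) exprS; apply: dvdz_mul => //; apply: (IHN (fun i => (c i %/ l)%Z)).
have /eqP : l%:Z%:~R * \sum_j (c j %/ l)%Z%:~R * E j = 0.
  by rewrite mulr_sumr -[RHS]c0; apply: eq_bigr => j _;
    rewrite [in RHS]lc rmorphM mulrA.
by rewrite mulf_eq0 intr_OK_eq0 eqz_nat (gtn_eqF (prime_gt0 lp)) /= => /eqP.
Qed.

(** Without an inclusion, each [P j] has an element [x i j] outside [P i]. The products [E i] then
    lie in every [P j] with [j != i] but not in [P i], which makes them linearly independent; there
    would be one more of them than the degree. *)
Lemma primes_over_collide l (P : 'I_m.+2 -> prime_idealr OK) :
    prime l -> (forall i, l%:R \in P i) ->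
  exists i j, i != j /\ {subset P i <= P j}.
Proof.
move=> lp Pl; apply: contrapT => nP.
have xP i j : exists x : OK, i != j -> x \in P j /\ x \notin P i.
  have [->|ij] := eqVneq i j; first by exists 0.
  apply: contrapT => /forallNP nx; apply: nP; exists j, i; split;
    first by rewrite eq_sym.
  by move=> x Px; apply: contrapT => /negP nPx; apply: (nx x).
pose x i j := projT1 (cid (xP i j)).
have xPE i j : i != j -> x i j \in P j /\ x i j \notin P i.
  exact: (projT2 (cid (xP i j))).
pose E i := \prod_(j | i != j) x i j.
have ErelN : forall c : 'I_m.+2 -> int, \sum_i (c i)%:~R * E i = 0 ->
  forall i, c i = 0.
  apply: (prime_dual_relation lp Pl) => [i|i j ij].
    by apply: prod_notin => j /xPE[].
  by apply: (@prod_in _ _ _ _ i); rewrite ?[j == i]eq_sym //;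
    apply: (xPE _ _ _).1; rewrite eq_sym.
have : free [tuple intval (E i) | i < m.+2].
  apply/freeP => k k0 i.
  have [D D0 Dk] := clear_denominators k.
  pose c j := numq (D%:~R * k j).
  have cE j : (c j)%:~R = D%:~R * k j by rewrite /c numqK.
  have /eqP : (c i)%:~R = 0 :> rat.
    rewrite ErelN //; apply: intval_inj; rewrite rmorph_sum rmorph0.
    transitivity (D%:~R *: \sum_j k j *: [tuple intval (E i) | i < m.+2]`_j);
      last first.
      by rewrite k0 scaler0.
    rewrite scaler_sumr; apply: eq_bigr => j _.
    rewrite -tnth_nth tnth_mktuple scalerA -cE rmorphM rmorph_int.
    by rewrite -(rmorph_int (in_alg K)) mulr_algl.
  by rewrite cE mulf_eq0 intr_eq0 (negPf D0) => /eqP.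
move=> /eqP; rewrite size_tuple => dimE.
have := dimvS (subvf <<[tuple intval (E i) | i < m.+2]>>%VS).
by rewrite dimE (size_basis eB) ltnn.
Qed.

End PrimesOver.

(** * Unramified primes and norms of elements of their squares *)

Section Unramified.
Variables (K : fieldExtType rat) (m : nat) (theta : ringOfIntegers K).
Local Notation OK := (ringOfIntegers K).
Local Notation e := (power_basis m theta).
Hypothesis eB : basis_of {:K} e.
Implicit Types (P : prime_idealr OK) (l : nat).

Lemma monic_divp (f g : {poly int}) : g \is monic ->
  exists q r, f = q * g + r /\ (size r < size g)%N.
Proof.
move=> gm; exists (Pdiv.Ring.rdivp f g), (Pdiv.Ring.rmodp f g).
by rewrite -Pdiv.RingMonic.rdivp_eq // Pdiv.Ring.ltn_rmodpN0 ?monic_neq0.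
Qed.

(* Modulo [l], a monic polynomial of least degree vanishing at [theta] modulo [P]
   generates the kernel of the reduction of [Z[theta]] modulo [P]. *)
Lemma small_zeval_mem P l (g r : {poly int}) : prime l -> l%:R \in P ->
    (forall p : {poly int}, p \is monic -> zeval p theta \in P ->
      (size g <= size p)%N) ->
    (size r < size g)%N -> zeval r theta \in P ->
  exists s, r = l%:Z%:P * s.
Proof.
move=> lp Pl gmin; have [n sr] := ubnP (size r).
elim: n r sr => // n IHn r sr rg Pr.
have [->|r0] := eqVneq r 0; first by exists 0; rewrite mulr0.
have size_lead (c : int) : (size (c%:P * 'X^((size r).-1))%R <= size r)%N.
  by rewrite mul_polyC (leq_trans (size_scale_leq _ _)) // size_polyXn prednK
    ?size_poly_gt0.
have [/dvdzP[q lcE]|lr] := boolP (l %| lead_coef r)%Z.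
  pose t := (q * l)%:P * 'X^((size r).-1) : {poly int}.
  have srt : (size (r - t)%R < size r)%N.
    rewrite -[size r]prednK ?size_poly_gt0 // ltnS; apply/leq_sizeP => j jr.
    rewrite coefB coefCM coefXn -lcE lead_coefE.
    move: jr; rewrite leq_eqVlt => /predU1P[<-|jr]; first by rewrite eqxx mulr1 subrr.
    by rewrite gtn_eqF // mulr0 subr0 nth_default // -[size r]prednK ?size_poly_gt0.
  have [|||s Ds] := IHn (r - t).
  - by rewrite (leq_trans srt) // -ltnS.
  - exact: leq_trans srt (ltnW rg).
  - rewrite -mulN1r zevalD !zevalM rpredD // idealMr //.
    by rewrite mulrC idealMr // zevalC rmorphM idealMr.
  - exists (s + q%:P * 'X^((size r).-1)).
    by rewrite mulrDr -Ds mulrA -polyCM [l%:Z * q]mulrC subrK.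
(* If [l] does not divide the leading coefficient, a Bezout combination with [l] times a monomial is
   monic of the same size as [r], contradicting the minimality of [g]. *)
have [u [v uv]] := prime_bezout lp lr.
pose p := u%:P * r + (v * l)%:P * 'X^((size r).-1).
have lp1 : p`_(size r).-1 = 1.
  by rewrite coefD !coefCM coefXn eqxx mulr1 -lead_coefE.
have sp : (size p <= size r)%N.
  apply: (leq_trans (size_polyD _ _)); rewrite geq_max size_lead.
  by rewrite mul_polyC size_scale_leq.
have spE : size p = size r.
  apply/eqP; rewrite eqn_leq sp -[size r]prednK ?size_poly_gt0 //.
  by rewrite ltnNge; apply/negP => /leq_sizeP/(_ _ (leqnn _)); rewrite lp1.
have pm : p \is monic by rewrite monicE lead_coefE spE lp1.
suff /(gmin p pm) : zeval p theta \in P by rewrite spE leqNgt rg.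
rewrite zevalD !zevalM !zevalC rpredD //; first by rewrite idealMr.
by rewrite mulrC idealMr // rmorphM idealMr.
Qed.

(* Locally at [P], the ideal [P] is generated by [l]. *)
Definition unramified l P :=
  exists2 h, h \notin P & forall x, x \in P -> exists y, h * x = l%:R * y.

(** Dedekind's criterion: modulo [l], [f] factors as [h * g] with [g] generating [P]. If [h] at
    [theta] lay in [P], so would the derivative of [f] at [theta], and [l] would divide its norm.
    Otherwise [h] sends [g], hence all of [P], into multiples of [l]; the index [D] accounts for
    integers outside [Z[theta]]. *)
Lemma almost_all_unramified :
  exists2 d : int, d != 0 & forall l P, prime l -> ~~ (l %| d)%Z -> l%:R \in P ->
    unramified l P.
Proof.
have [D D0 DO] := power_basis_index eB; have [f [fm sf f0]] := power_basis_poly eB.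
pose f1 := zeval f^`() theta.
have f10 : f1 != 0.
  apply: contraTneq isT => /(zeval_eq0 eB) f'0.
  have : (f^`())`_m = 0.
    by rewrite f'0 ?coef0 // -ltnS -sf lt_size_deriv // -size_poly_gt0 sf.
  rewrite coef_deriv; have /monicP := fm; rewrite lead_coefE sf /= => -> /eqP.
  by rewrite mulrn_eq0.
exists (D * norm m theta f1); first by rewrite mulf_neq0 ?(norm_neq0 eB).
move=> l P lp; rewrite dvdzE abszM Euclid_dvdM // negb_or -!dvdzE => /andP[lD lN] Pl.
have exg : exists n, `[< exists g : {poly int},
    [/\ g \is monic, size g = n & zeval g theta \in P] >].
  by exists m.+2; apply/asboolP; exists f; rewrite f0 rpred0.
have [n /asboolP[g [gm sg Pg]] nmin] := ex_minnP exg.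
have gmin p : p \is monic -> zeval p theta \in P -> (size g <= size p)%N.
  by move=> pm Pp; rewrite sg; apply: nmin; apply/asboolP; exists p.
have [h [r [fE rg]]] := monic_divp f gm.
have [//|s rE] := small_zeval_mem lp Pl gmin rg.
  have := f0; rewrite fE zevalD zevalM => /eqP; rewrite addrC addr_eq0 => /eqP ->.
  by rewrite rpredN idealMr.
have hg : zeval h theta * zeval g theta = - (l%:R * zeval s theta).
  apply/eqP; rewrite -addr_eq0; apply/eqP; rewrite -[RHS]f0 fE rE zevalD !zevalM.
  by rewrite zevalC.
exists (zeval h theta) => [|x Px].
  apply: contra lN => Ph; rewrite -(mem_ideal_int _ lp Pl).
  have [z <-] := norm_dvd eB f1; rewrite mulrC idealMr //.
  rewrite /f1 fE rE derivD !derivM derivC mul0r add0r !zevalD !zevalM zevalC.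
  rewrite rpredD //; last by rewrite mulrC idealMr.
  by rewrite rpredD //; [rewrite idealMr|rewrite mulrC idealMr].
have [y Dx] := DO x; have [a ya] := comb_zeval theta y.
have [q [r' [aE rg']]] := monic_divp a gm.
have [//|s' rE'] := small_zeval_mem lp Pl gmin rg'.
  have : zeval a theta \in P by rewrite -ya -Dx idealMr.
  by rewrite aE zevalD zevalM rpredDl // idealMr.
have [u [v uv]] := prime_bezout lp lD.
pose w := zeval h theta * zeval s' theta - zeval q theta * zeval s theta.
have hDx : zeval h theta * (D%:~R * x) = l%:R * w.
  rewrite Dx ya aE rE' zevalD !zevalM zevalC mulrDr mulrCA hg /w.
  by rewrite -pmulrn; ring.
(* The relation was obtained for [D * x]; Bezout between [D] and [l] removes the factor [D]. *)
exists (u%:~R * w + v%:~R * (zeval h theta * x)).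
transitivity ((u * D + v * l)%:~R * (zeval h theta * x)); first by rewrite uv mul1r.
rewrite rmorphD !rmorphM mulrDl /= -pmulrn.
rewrite -[u%:~R * _ * _]mulrA [D%:~R * _]mulrCA hDx; ring.
Qed.

(** The norm is a multiple of [z], so [h ^ 2] times it is divisible by [l ^ 2]. As [h] is outside
    [P], one factor [l] can be extracted from the norm, cancelled, and extracted again. Hence
    nonzero elements of [P^2] have norm at least [l ^ 2] in absolute value. *)
Lemma norm_sqr_dvd l P z : prime l -> l%:R \in P -> unramified l P ->
  ideal_exp [set` P] 2 z -> (l%:Z ^+ 2 %| norm m theta z)%Z.
Proof.
move=> lp Pl [h Ph hP] Pz.
have [y] : exists y, h ^+ 2 * (norm m theta z)%:~R = l%:R ^+ 2 * y.
  apply: (ideal_exp_clear hP); have [z' <-] := norm_dvd eB z.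
  by rewrite mulrC; apply: ideal_expMl.
have hE (c : int) (y' : OK) : h ^+ 2 * c%:~R = l%:R * y' -> (l %| c)%Z.
  move=> hcy; rewrite -(mem_ideal_int _ lp Pl).
  have : h ^+ 2 * c%:~R \in P by rewrite hcy mulrC idealMr.
  by rewrite expr2 !prime_idealrM (negPf Ph).
rewrite [X in _ = X * _]expr2 -[in RHS]mulrA => hN; have /dvdzP[q qE] := hE _ _ hN.
have {}hN : h ^+ 2 * q%:~R * l%:R = l%:R * y * l%:R.
  by move: hN; rewrite qE rmorphM /= -pmulrn => hN; rewrite -mulrA hN; ring.
have l0 : l%:R != 0 :> OK.
  by rewrite -[l%:R]/(l%:Z%:~R) intr_OK_eq0 eqz_nat -lt0n prime_gt0.
have /dvdzP[q' q'E] : (l %| q)%Z.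
  by apply: (hE _ y); apply: (mulIf l0).
by rewrite qE q'E -mulrA -expr2 dvdz_mull.
Qed.

End Unramified.

(** * Primes of degree one *)

Section PrimeDivisors.
Implicit Types (f p : {poly int}).

Lemma horner_sub_dvdz f (s t : int) : (t - s %| f.[t] - f.[s])%Z.
Proof.
have /factor_theorem[q qE] : root (f - f.[s]%:P) s by rewrite /root !hornerE subrr.
have := congr1 (fun p => p.[t]) qE; rewrite !hornerE => ->.
exact: dvdz_mull.
Qed.

Lemma nonroot_exists p (t : nat -> int) : p != 0 -> injective t ->
  exists s, p.[t s] != 0.
Proof.
move=> p0 tI; apply: contrapT => /forallNP root_t.
have := @max_poly_roots _ p [seq t s | s <- iota 0 (size p)] p0.
rewrite map_inj_uniq // iota_uniq size_map size_iota ltnn => absurd;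
  suff /absurd/(_ isT) : all (root p) [seq t s | s <- iota 0 (size p)] by [].
by apply/allP => _ /mapP[s _ ->]; apply: contrapT => /negP/root_t.
Qed.

(* Euclid's argument applied to the values [f(t0 + f(t0) B! s) / f(t0)]. *)
Lemma large_prime_divisor f (B : nat) : (1 < size f)%N ->
  exists l (t : int), [/\ prime l, (B < l)%N & (l %| f.[t])%Z].
Proof.
move=> sf.
have fC (c : int) : f - c%:P != 0.
  rewrite subr_eq0; apply: contraTneq sf => ->.
  by rewrite -leqNgt size_polyC leq_b1.
have [s0] : exists s : nat, f.[s%:Z] != 0.
  by apply: nonroot_exists; [rewrite -[f]subr0 -(polyC0) fC | move=> i j []].
set t0 := s0%:Z; set c := f.[t0] => c0.
have B0 : (B`!%:Z : int) != 0 by rewrite eqz_nat -lt0n fact_gt0.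
(* Avoiding the values [c] and [- c] keeps the cofactor [u] of [c] in [f.[t]] different from 1 and
   -1, so that it is zero or has a prime divisor. *)
have [s] : exists s : nat, ((f - c%:P) * (f - (- c)%:P)).[t0 + c * B`!%:Z * s%:Z]
  != 0.
  apply: (@nonroot_exists _ (fun s : nat => t0 + c * B`!%:Z * s%:Z)).
    by rewrite mulf_neq0 ?fC.
  by move=> i j /addrI/(mulfI (mulf_neq0 c0 B0)) [].
set t := t0 + _; rewrite !hornerE mulf_eq0 negb_or subr_eq0 opprK addr_eq0 =>
  /andP[ftc ftNc].
have /dvdzP[q qE] : (c * B`!%:Z %| f.[t] - c)%Z.
  apply: dvdz_trans (horner_sub_dvdz f t0 t).
  by rewrite /t addrC addKr dvdz_mulr.
have ftE : f.[t] = c * (1 + B`!%:Z * q) by rewrite -[LHS](subrK c) qE; ring.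
set u := 1 + _ in ftE.
have [u0|u0] := eqVneq u 0.
  have [l Bl lp] := prime_above B; exists l, t; split=> //.
  by rewrite ftE u0 mulr0 dvdz0.
have u1 : (1 < `|u|)%N.
  rewrite ltn_neqAle eq_sym absz_gt0 u0 andbT eqn_leq; apply/negP => u1.
  have [uE|uE] : u = 1 \/ u = -1 by lia.
    by rewrite ftE uE mulr1 eqxx in ftc.
  by rewrite ftE uE mulrN1 eqxx in ftNc.
exists (pdiv `|u|), t; split; first exact: pdiv_prime.
  rewrite ltnNge; apply/negP => lB.
  have lB' : (pdiv `|u| %| B`!%:Z * q)%Z.
    by apply: dvdz_mulr; rewrite dvdzE !absz_nat dvdn_fact // pdiv_gt0.
  have lu : (pdiv `|u| %| u)%Z by rewrite dvdzE absz_nat pdiv_dvd.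
  have := rpredB lu lB'; rewrite /u addrK dvdzE absz_nat dvdn1 => /eqP l1.
  by have := pdiv_prime u1; rewrite l1.
by rewrite ftE dvdz_mull // dvdzE absz_nat pdiv_dvd.
Qed.

Lemma prime_dvdzM (l : nat) (a b : int) : prime l ->
  (l %| a * b)%Z = (l %| a)%Z || (l %| b)%Z.
Proof. by move=> lp; rewrite !dvdzE abszM Euclid_dvdM. Qed.

End PrimeDivisors.

Section DegreeOne.
Variables (K : fieldExtType rat) (m : nat) (theta : ringOfIntegers K).
Local Notation OK := (ringOfIntegers K).
Local Notation e := (power_basis m theta).
Hypothesis eB : basis_of {:K} e.

(** The difference [a - b] is a multiple of [f], since its remainder has too small a degree to
    vanish at [theta]. So sending [theta] to a root [t] of [f] modulo [l] is a well-defined ring map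
    on [Z[theta]]. *)
Lemma zeval_same_mod (f a b : {poly int}) (l : nat) (t : int) :
    f \is monic -> size f = m.+2 -> zeval f theta = 0 -> (l %| f.[t])%Z ->
  zeval a theta = zeval b theta -> (l %| a.[t] - b.[t])%Z.
Proof.
move=> fm sf f0 lf ab; have [q [r [abE rs]]] := monic_divp (a - b) fm.
have -> : a.[t] - b.[t] = q.[t] * f.[t].
  have r0 : r = 0.
    apply: (zeval_eq0 eB); first by rewrite -ltnS -sf.
    have : zeval (a - b) theta = 0.
      by rewrite -mulN1r zevalD zevalM -polyC1 -polyCN zevalC ab; ring.
    by rewrite abE zevalD zevalM f0 mulr0 add0r.
  have := congr1 (fun p : {poly int} => p.[t]) abE.
  by rewrite r0 !hornerE.
exact: dvdz_mull.
Qed.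

(** The map from [Z[theta]] to the field with [l] elements extends to all integers when its index
    factor [D] is invertible modulo [l], which [l > |D|] ensures. [P] is the kernel of the
    extension, and an inverse of [D] modulo [l] yields the integer representatives. *)
Lemma degree_one_prime (B : nat) : exists l (P : prime_idealr OK),
  [/\ prime l, (B < l)%N, l%:R \in P & forall x, exists c : int, x - c%:~R \in P].
Proof.
have [D D0 DO] := power_basis_index eB; have [f [fm sf f0]] := power_basis_poly eB.
have [|l [t [lp Bl lf]]] := @large_prime_divisor f (B + `|D|); first by rewrite sf.
have lD : ~~ (l %| D)%Z.
  by rewrite dvdzE absz_nat gtnNdvd ?absz_gt0 //; apply: leq_ltn_trans Bl;
    rewrite leq_addl.
have wd := zeval_same_mod fm sf f0 lf.
have DZ x : exists a, D%:~R * x = zeval a theta.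
  by have [y ->] := DO x; have [a ->] := comb_zeval theta y; exists a.
pose S : OK -> bool := fun x =>
  `[< exists a, D%:~R * x = zeval a theta /\ (l %| a.[t])%Z >].
have SI : idealr_closed S.
  split.
  - by apply/asboolP; exists 0; rewrite mulr0 horner0 dvdz0 /zeval map_poly0 horner0.
  - apply: contra lD => /asboolP[a [aE la]].
    have := wd a D%:P; rewrite -aE zevalC mulr1 hornerC => /(_ erefl).
    by rewrite rpredBl.
  - move=> x u v /asboolP[a [aE la]] /asboolP[b [bE lb]]; apply/asboolP.
    have [c cE] := DZ (x * u + v); have [d dE] := DZ x; exists c; split=> //.
    have := wd (D%:P * c) (d * a + D%:P * b).
    rewrite !hornerE zevalD !zevalM zevalC -cE -dE -aE -bE => /(_ _).
    have -> : D%:~R * (D%:~R * (x * u + v)) =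
      D%:~R * x * (D%:~R * u) + D%:~R * (D%:~R * v) by ring.
    move=> /(_ erefl); rewrite rpredBr; last by rewrite rpredD // dvdz_mull.
    by rewrite prime_dvdzM // (negPf lD).
have SP : prime_idealr_closed S.
  move=> u v /asboolP[c [cE lc]].
  have [a aE] := DZ u; have [b bE] := DZ v.
  have : (l %| a.[t] * b.[t])%Z.
    have := wd (a * b) (D%:P * c).
    rewrite !hornerE !zevalM zevalC -cE -aE -bE.
    have -> : D%:~R * u * (D%:~R * v) = D%:~R * (D%:~R * (u * v)) by ring.
    by move=> /(_ erefl); rewrite rpredBr // dvdz_mull.
  rewrite prime_dvdzM // => /orP[la|lb]; apply/orP; [left|right]; apply/asboolP.
    by exists a.
  by exists b.
pose P : prime_idealr OK := HB.pack S (isIdealr.Build OK S SI)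
  (isPrimeIdealrClosed.Build OK S SP).
exists l, P; split=> //.
- apply: leq_ltn_trans Bl; exact: leq_addr.
- apply/asboolP; exists (D * l)%:P; rewrite zevalC hornerC dvdz_mull // rmorphM.
  by rewrite /= -pmulrn.
move=> x; have [a aE] := DZ x; have [u [v uv]] := prime_bezout lp lD.
exists (u * a.[t]); apply/asboolP; exists (a - (D * (u * a.[t]))%:P).
split.
  rewrite mulrBr aE -rmorphM -[X in _ = zeval (_ + X) _]mulN1r zevalD zevalM.
  by rewrite -polyC1 -polyCN !zevalC; ring.
have -> : (a - (D * (u * a.[t]))%:P).[t] = a.[t] * v * l.
  by rewrite hornerD hornerN hornerC -[X in X - _]mulr1 -uv; ring.
exact: dvdz_mull.
Qed.

End DegreeOne.

(** * The sieve *)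

Lemma card_le_fibres (T I : finType) (A : pred T) (f : T -> I) (b : nat) :
  (forall i, (#|[pred x | A x && (f x == i)]| <= b)%N) -> (#|A| <= b * #|I|)%N.
Proof.
move=> fb; rewrite -sum1_card (partition_big f predT) //= mulnC -sum_nat_const.
by apply: leq_sum => i _; rewrite sum1_card; apply: leq_trans (fb i).
Qed.

(** Telescoping comparison with [1 / L - 1 / (L + 1)]. *)
Lemma sum_inv_sqr_le (Q L : nat) : (0 < Q)%N ->
  \sum_(Q.+1 <= l < L.+1) (l%:R ^+ 2)^-1 <= Q%:R^-1 :> rat.
Proof.
move=> Q0; have [LQ|QL] := ltnP L Q; first by rewrite big_geq ?invr_ge0 // ltnS ltnW.
suff : \sum_(Q.+1 <= l < L.+1) (l%:R ^+ 2)^-1 <= Q%:R^-1 - L%:R^-1 :> rat.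
  by move=> /le_trans; apply; rewrite lerBlDr lerDl invr_ge0.
elim: L QL => [|L IHL]; first by rewrite leqn0 => /eqP Q0'; rewrite Q0' in Q0.
rewrite leq_eqVlt => /predU1P[<-|QL]; first by rewrite big_geq ?subrr.
rewrite big_nat_recr //=.
have L0 : (0 < L)%N by exact: leq_trans Q0 QL.
have Lr : 0 < L%:R :> rat by rewrite ltr0n.
suff step : (L.+1%:R ^+ 2)^-1 <= L%:R^-1 - L.+1%:R^-1 :> rat.
  by apply: le_trans (lerD (IHL QL) step) _; rewrite addrA subrK.
rewrite -[L.+1%:R]natr1; set x : rat := L%:R in Lr *.
have -> : x^-1 - (x + 1)^-1 = (x * (x + 1))^-1 by field; lra.
by rewrite lef_pV2 ?posrE; nra.
Qed.

(** This selects the side [s] of a sieve cell: small enough that differences within a cell have norm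
    below [l ^ 2], and maximal so that cells are few. *)
Lemma root_bracket (C l n : nat) : (0 < C)%N -> (C < l ^ 2)%N -> (0 < n)%N ->
  exists s, [/\ (0 < s)%N, (C * s ^ n < l ^ 2)%N & (l ^ 2 <= C * s.+1 ^ n)%N].
Proof.
move=> C0 Cl n0.
have ex : exists s, (l ^ 2 <= C * s.+1 ^ n)%N.
  exists (l ^ 2)%N; apply: (@leq_trans (l ^ 2).+1 _ _ (leqnSn _)).
  by rewrite (leq_trans _ (leq_pmull _ C0)) // -{1}(expn1 (l ^ 2).+1) leq_pexp2l.
have [s ls smin] := ex_minnP ex.
case: s ls smin => [|s] ls smin.
  by move: ls; rewrite exp1n muln1 leqNgt Cl.
by exists s.+1; split=> //; rewrite ltnNge; apply/negP => /smin; rewrite ltnn.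
Qed.

Lemma card_union_bound (T : finType) (r : seq nat) (A : pred T) (B : nat -> pred T) :
  (forall y, A y || has (fun l => B l y) r) ->
    (#|T| <= #|A| + \sum_(l <- r) #|B l|)%N.
Proof.
move=> cover; have cardE (C : pred T) : #|C| = (\sum_y C y)%N.
  by rewrite -sum1_card big_mkcond; apply: eq_bigr => y _; rewrite unfold_in;
    case: (C y).
rewrite (cardE A) -sum1_card; under [in X in (_ + X)%N]eq_bigr do rewrite cardE.
rewrite exchange_big -big_split /=; apply: leq_sum => y _.
case/orP: (cover y) => [-> //|/hasP[l rl Bl]].
by rewrite (big_rem l rl) /= Bl addnCA.
Qed.

(** The number of cells is [O(N^n / l^2 + 1)]. The two factors [2 ^ n] come from [s + 1 <= 2 * s]
    and from separating the 1 in [(a + 1)^n]. *)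
Lemma cell_count (n C N s l : nat) : (0 < n)%N -> (0 < s)%N ->
  (l ^ 2 <= C * s.+1 ^ n)%N ->
  (l ^ 2 * (N %/ s).+1 ^ n <= 2 ^ n * (C * 2 ^ n * N ^ n + l ^ 2))%N.
Proof.
move=> n0 s0 lC; set a := (N %/ s)%N.
have aE : (a.+1 ^ n <= 2 ^ n * (a ^ n + 1))%N.
  case: (a) => [|b]; first by rewrite exp1n exp0n // muln1 expn_gt0.
  apply: (@leq_trans (2 ^ n * b.+1 ^ n)); last by rewrite leq_mul2l leq_addr orbT.
  by rewrite -expnMn leq_exp2r //; lia.
have lE : (l ^ 2 * a ^ n <= C * 2 ^ n * N ^ n)%N.
  apply: (@leq_trans (C * s.+1 ^ n * a ^ n)); first by rewrite leq_mul2r lC orbT.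
  apply: (@leq_trans (C * (2 * s) ^ n * a ^ n)).
    by rewrite leq_mul2r leq_mul2l leq_exp2r // -[s.+1]add1n mul2n -addnn leq_add2r
      s0 !orbT.
  rewrite expnMn mulnA -mulnA leq_mul2l -expnMn leq_exp2r // [(s * a)%N]mulnC.
  by rewrite leq_trunc_div orbT.
apply: (@leq_trans (l ^ 2 * (2 ^ n * (a ^ n + 1))));
  first by rewrite leq_mul2l aE orbT.
by rewrite mulnCA leq_mul2l mulnDr muln1 leq_add2r lE orbT.
Qed.

Section Sieve.
Variables (K : fieldExtType rat) (m : nat) (theta : ringOfIntegers K).
Local Notation OK := (ringOfIntegers K).
Local Notation e := (power_basis m theta).
Hypothesis eB : basis_of {:K} e.
Implicit Types (P : prime_idealr OK) (l : nat).

Definition box N := {ffun 'I_m.+1 -> 'I_N}.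

Definition box_point (c : OK) (M N : nat) (y : box N) : OK :=
  c + M%:R * comb theta (fun i => (y i)%:Z).

(** The square controls every exponent [k >= 2], because [P^k] lies in [P^2]. *)
Definition sqr_bad l (x : OK) : bool :=
  `[< exists P, l%:R \in P /\ ideal_exp [set` P] 2 x >].

Section Cells.
Variable C1 : nat.
Hypothesis normC1 : forall (N : nat) (y : 'I_m.+1 -> int), (0 < N)%N ->
  (forall i, `|y i| <= N%:R) -> `|norm m theta (comb theta y)| <= (C1 * N ^ m.+1)%:R.

(* Two points of one small cell that are bad for the same prime [P] differ by an
   element of [P^2] whose norm is too small; so distinct bad points of a cell
   come from distinct primes over [l], of which there are at most [m.+1]. *)
Lemma bad_card (c : OK) (M N s l : nat) :
    prime l -> ~~ (l %| M)%N ->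
    (forall P, l%:R \in P -> unramified l P) ->
    (0 < s)%N -> (C1 * s ^ m.+1 < l ^ 2)%N ->
  (#|[pred y : box N | sqr_bad l (box_point c M y)]| <= m.+1 * (N %/ s).+1 ^ m.+1)%N.
Proof.
move=> lp lM unr s0 sl.
pose cell (y : box N) : {ffun 'I_m.+1 -> 'I_(N %/ s).+1} := [ffun i =>
  inord (y i %/ s)].
have cellE (y y' : box N) : cell y = cell y' ->
  forall i, `|(y i)%:Z - (y' i)%:Z| <= s%:R.
  move=> /ffunP yy' i; have := congr1 (@nat_of_ord _) (yy' i);
    rewrite !ffunE !inordK ?ltnS; last 2 first.
  - by apply: leq_div2r; apply: ltnW.
  - by apply: leq_div2r; apply: ltnW.
  move=> yy.
  have := divn_eq (y i) s; have := divn_eq (y' i) s; rewrite yy.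
  have := ltn_pmod (y i) s0; have := ltn_pmod (y' i) s0.
  move: (_ %% _)%N (_ %% _)%N (_ %/ _ * _)%N => r r' q; rewrite natz; lia.
have -> : ((N %/ s).+1 ^ m.+1)%N = #|{: {ffun 'I_m.+1 -> 'I_(N %/ s).+1}}|.
  by rewrite card_ffun !card_ord.
apply: (card_le_fibres (f := cell)) => q; rewrite leqNgt; apply/negP => many.
pose y (i : 'I_m.+2) : box N := enum_val (widen_ord many i).
have yP i : sqr_bad l (box_point c M (y i)) && (cell (y i) == q).
  by have := enum_valP (widen_ord many i).
have yI : injective y by move=> i j /enum_val_inj/(congr1 val)/= /val_inj.
have PP i : exists P, l%:R \in P /\ ideal_exp [set` P] 2 (box_point c M (y i)).
  by have /andP[/asboolP] := yP i.
pose P i := projT1 (cid (PP i)).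
have PE i : l%:R \in P i /\ ideal_exp [set` P i] 2 (box_point c M (y i)).
  exact: (projT2 (cid (PP i))).
have [i [j [ij Pij]]] := primes_over_collide eB lp (fun i => (PE i).1).
have yij : y i != y j by apply: contra_neq ij => /yI.
set Pj := P j in Pij; have [Pl Pxj] := PE j; rewrite -/Pj in Pl Pxj.
pose z := comb theta (fun k => (y i k)%:Z - (y j k)%:Z).
have Mz : ideal_exp [set` Pj] 2 (M%:R * z).
  have -> : M%:R * z = box_point c M (y i) - box_point c M (y j).
    by rewrite /z -combB /box_point; ring.
  apply: ideal_expB => //; rewrite -[box_point c M (y i)]mul1r.
  exact: (ideal_exp_morph (f := idfun) _ Pij (PE i).2).
have Pz : ideal_exp [set` Pj] 2 z.
  (* Squaring the Bezout relation cancels [M] modulo [l ^ 2], and multiples of [l ^ 2] lie in the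
     square of [Pj]. *)
  have [u [v uv]] := @prime_bezout l M lp lM.
  have -> : z = (u * (u * M + 2 * v * l))%:~R * (M%:R * z) + v%:~R ^+ 2 * z * l%:R
    ^+ 2.
    have := congr1 (fun c : int => (c ^+ 2)%:~R * z) uv.
    rewrite expr1n mul1r => {1}<-; rewrite !(rmorphXn, rmorphD, rmorphM) /=
      -!pmulrn; ring.
  by apply: ideal_expD; apply: ideal_expMl => //; apply: ideal_exp_self.
have z0 : z != 0.
  apply: contra_neq yij => /(comb_eq0 eB) z0; apply/ffunP => k; apply: val_inj => /=.
  by have := z0 k; lia.
have := norm_sqr_dvd eB lp Pl (unr _ Pl) Pz.
rewrite dvdzE abszX absz_nat => /dvdn_leq;
  rewrite absz_gt0 (norm_neq0 eB z0) => /(_ isT).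
rewrite leqNgt => /negP; apply; apply: leq_ltn_trans sl.
have := normC1 s0 (cellE (y i) (y j) _); rewrite -/z => /(_ _).
have /andP[_ /eqP ->] := yP i; have /andP[_ /eqP ->] := yP j.
by move=> /(_ erefl); rewrite natz -abszE lez_nat.
Qed.

End Cells.

(** Zero lies in all powers of all primes and escapes the norm bound, so the sieve counts it
    separately. *)
Lemma box_point_zero (c : OK) (M N : nat) : (0 < M)%N ->
  (#|[pred y : box N | box_point c M y == 0%R]| <= 1)%N.
Proof.
move=> M0; apply/card_le1_eqP => y y'; rewrite !inE => /eqP y0 /eqP y'0.
have : M%:R * comb theta (fun i => (y i)%:Z - (y' i)%:Z) = 0.
  have -> : 0 = box_point c M y - box_point c M y' by rewrite y0 y'0 subrr.
  by rewrite -combB /box_point; ring.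
move/eqP; rewrite mulf_eq0 pmulrn intr_OK_eq0 eqz_nat gtn_eqF //= => /eqP.
move=> /(comb_eq0 eB) yy'; apply/ffunP => k; apply: val_inj => /=.
by have := yy' k; lia.
Qed.

(* In a box of side [N] a prime [l > Q] spoils [O(N^n / l^2 + 1)] points, and only
   [l = O(N^(n/2))] can spoil a nonzero point; for [Q] and then [N] large the sum
   of these bounds is smaller than [N^n]. *)
Lemma sieve : exists Q0 : nat, forall (Q M : nat) (c : OK), (Q0 <= Q)%N ->
  (0 < M)%N ->
    (forall l, prime l -> (Q < l)%N -> ~~ (l %| M)%N) ->
  exists w, forall l P, prime l -> (Q < l)%N -> l%:R \in P ->
    ~ ideal_exp [set` P] 2 (c + M%:R * w).
Proof.
have [d d0 unr] := almost_all_unramified eB.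
have [C1' hC1'] := norm_bound eB 0 1; pose C1 := C1'.+1.
have hC1 (N : nat) (y : 'I_m.+1 -> int) : (0 < N)%N ->
  (forall i, `|y i| <= N%:R) -> `|norm m theta (comb theta y)| <= (C1 * N ^ m.+1)%:R.
  move=> N0 yN; have := hC1' N y N0 yN; rewrite mul1r add0r => /le_trans; apply.
  by rewrite ler_nat leq_mul2r leqnSn orbT.
pose F := (m.+1 * 2 ^ m.+1)%N; pose E := (F * (C1 * 2 ^ m.+1))%N.
(* The term [|d|] makes every prime over [l > Q] unramified, [C1] gives [C1 < l ^ 2] as
   [root_bracket] requires, and [2 * E] makes [E / Q] at most one half. *)
exists (`|d| + C1 + 2 * E)%N => Q M c QQ M0 QM.
have [C2' hC2'] := norm_bound eB c M; pose C2 := C2'.+1.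
(* [N] is a square so that [X], the square root of the box size, is an integer. [L] bounds the
   primes that spoil a nonzero point, as [l ^ 2 <= C2 * X ^ 2]. Finally [R <= X] forces
   [X ^ 2 / 2 > 1 + F * C2 * X], the contradiction sought. *)
pose R := (2 * (1 + F * C2)).+1; pose N := (R ^ 2)%N.
pose X := (R ^ m.+1)%N; pose L := (C2 * X)%N.
have NX : (N ^ m.+1 = X ^ 2)%N by rewrite /N /X -!expnM mulnC.
have N0 : (0 < N)%N by rewrite expn_gt0.
have Q_gt0 : (0 < Q)%N by apply: leq_trans QQ; rewrite /C1; lia.
apply: contrapT => /forallNP all_bad.
pose B l (y : box N) := prime l && sqr_bad l (box_point c M y).
have cover y : (box_point c M y == 0) || has (fun l => B l y) (index_iota Q.+1 L.+1).
  have [//|y0 /=] := eqVneq (box_point c M y) 0.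
  have /existsNP[l /existsNP[P /not_implyP[lp /not_implyP[Ql /not_implyP[Pl
    /contrapT Py]]]]] :=
    all_bad (comb theta (fun i => (y i)%:Z)).
  apply/hasP; exists l; last by rewrite /B lp; apply/asboolP; exists P.
  rewrite mem_index_iota ltnS Ql /= -(@leq_exp2r _ _ 2) //.
  have ld : ~~ (l %| d)%Z.
    by rewrite dvdzE absz_nat gtnNdvd ?absz_gt0 //; apply: leq_ltn_trans Ql;
      apply: leq_trans QQ; lia.
  have := norm_sqr_dvd eB lp Pl (unr _ _ lp ld Pl) Py.
  rewrite dvdzE abszX absz_nat => /dvdn_leq;
    rewrite absz_gt0 (norm_neq0 eB y0) => /(_ isT).
  move=> /leq_trans; apply.
  have yN i : `|(y i)%:Z| <= N%:R by rewrite natz -abszE lez_nat absz_nat ltnW.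
  have := hC2' N _ N0 yN; rewrite -/(box_point c M y) natz -abszE lez_nat =>
    /leq_trans; apply.
  rewrite NX /L expnMn leq_mul2r (leq_trans (leqnSn C2')) ?orbT //.
  by rewrite -[C2'.+1]/C2 -{1}(expn1 C2) leq_pexp2l.
have B_le l : (Q < l)%N -> #|B l|%:R <= (E * X ^ 2)%:R * (l%:R ^+ 2)^-1 + F%:R :> rat.
  move=> Ql; have l0 : (0 < l)%N by apply: leq_trans Ql.
  have [lp|lp] := boolP (prime l); last first.
    rewrite eq_card0 => [|y]; last by rewrite /B inE (negPf lp).
    by rewrite addr_ge0 // mulr_ge0 // invr_ge0 exprn_ge0.
  have ld : ~~ (l %| d)%Z.
    by rewrite dvdzE absz_nat gtnNdvd ?absz_gt0 //; apply: leq_ltn_trans Ql;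
      apply: leq_trans QQ; lia.
  have C1l : (C1 < l ^ 2)%N.
    apply: (@leq_trans l); last by rewrite -{1}(expn1 l) leq_pexp2l.
    by apply: leq_ltn_trans Ql; apply: leq_trans QQ; lia.
  have [s [s0 sl ls]] := root_bracket (isT : 0 < C1)%N C1l (isT : 0 < m.+1)%N.
  have := bad_card hC1 c N lp (QM _ lp Ql) (fun P => unr l P lp ld) s0 sl.
  have := cell_count N (isT : 0 < m.+1)%N s0 ls.
  rewrite NX; set k := #|_|; set k' := #|_| => h1 h2.
  have kk : k' = k by apply: eq_card => y; rewrite /B !inE lp.
  rewrite -{}kk in h2 *.
  have h3 : (l ^ 2 * k' <= E * X ^ 2 + F * l ^ 2)%N.
    apply: leq_trans (_ : m.+1 * (2 ^ m.+1 * (C1 * 2 ^ m.+1 * X ^ 2 + l ^ 2)) <= _)%N.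
      apply: leq_trans (_ : l ^ 2 * (m.+1 * (N %/ s).+1 ^ m.+1) <= _)%N.
        by rewrite leq_mul2l h2 orbT.
      by rewrite mulnCA leq_mul2l h1 orbT.
    by rewrite mulnA -/F mulnDr /E !mulnA.
  have l2 : 0 < l%:R ^+ 2 :> rat by rewrite exprn_gt0 ?ltr0n.
  rewrite -(ler_pM2l l2) mulrDr mulrCA divff ?gt_eqF // mulr1 [_ * F%:R]mulrC.
  by rewrite -!natrX -!natrM -natrD ler_nat.
have := card_union_bound (A := fun y => box_point c M y == 0) cover.
rewrite card_ffun !card_ord NX -(ler_nat rat) => Xle.
have {Xle} : (X ^ 2)%:R <= 1 + ((E * X ^ 2)%:R / Q%:R + F%:R * L%:R) :> rat.
  apply: (le_trans Xle); rewrite natrD; apply: lerD.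
    by rewrite (ler_nat _ _ 1) box_point_zero.
  rewrite natr_sum.
  apply: (@le_trans _ _ (\sum_(Q.+1 <= l < L.+1) ((E * X ^ 2)%:R * (l%:R ^+ 2)^-1 +
    F%:R))).
    by apply: ler_sum_nat => l /andP[Ql _]; apply: B_le.
  rewrite big_split /= -mulr_sumr; apply: lerD.
    by rewrite ler_wpM2l // sum_inv_sqr_le.
  rewrite sumr_const_nat -[leLHS]mulr_natr ler_wpM2l // ler_nat subSS;
    exact: leq_subr.
apply/negP; rewrite -ltNge.
have QE : E%:R / Q%:R <= 2^-1 :> rat.
  rewrite ler_pdivrMr ?ltr0n // mulrC ler_pdivlMr // -natrM ler_nat.
  by apply: leq_trans QQ; lia.
have XR : R%:R <= X%:R :> rat.
  by rewrite ler_nat /X -{1}(expn1 R) leq_pexp2l.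
have X0 : 0 <= X%:R :> rat by [].
have RE : R%:R = 2 * (1 + F%:R * C2%:R) + 1 :> rat.
  by rewrite /R -addn1 natrD natrM natrD natrM.
rewrite /L (natrM _ E (X ^ 2)) (natrM _ C2 X) !(natrX _ X 2) mulrAC.
move: QE XR X0 RE; move: (X%:R : rat) (R%:R : rat) (E%:R / Q%:R) => x r q.
have : 0 <= F%:R * C2%:R :> rat by rewrite mulr_ge0.
rewrite [F%:R * (_ * x)]mulrA; move: (F%:R * C2%:R) => g g0 qh rx x0 rE.
have : q * x ^+ 2 <= 2^-1 * x ^+ 2 by rewrite ler_wpM2r ?exprn_ge0.
nra.
Qed.

End Sieve.

(** * k-free integers in residue classes *)

Section Progression.
Variables (K : fieldExtType rat) (m : nat) (theta : ringOfIntegers K).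
Local Notation OK := (ringOfIntegers K).
Local Notation e := (power_basis m theta).
Hypothesis eB : basis_of {:K} e.
Implicit Types (P : prime_idealr OK) (l p : nat).

Lemma natr_OK_neq0 n : (0 < n)%N -> n%:R != 0 :> OK.
Proof. by move=> n0; rewrite pmulrn intr_OK_eq0 eqz_nat -lt0n. Qed.

Lemma nonzero_above l P : prime l -> l%:R \in P -> nonzero_ideal [set` P].
Proof. by move=> lp Pl; exists l%:R => //; rewrite natr_OK_neq0 ?prime_gt0. Qed.

Lemma ideal_exp_shift P k l x w : l%:R \in P ->
  ideal_exp [set` P] k (x + (l ^ k)%:R * w) -> ideal_exp [set` P] k x.
Proof.
move=> Pl Pxw; rewrite -[x](addrK ((l ^ k)%:R * w)); apply: ideal_expB => //.
by rewrite mulrC natrX; apply/ideal_expMl/ideal_exp_self.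
Qed.

Definition prime_cofactor (Q p : nat) : nat :=
  \prod_(l <- index_iota 0 Q.+1 | prime l && (l != p)) l.

Lemma dvd_prime_cofactor Q p l : prime l -> (l %| prime_cofactor Q p)%N ->
  (l <= Q)%N && (l != p).
Proof.
move=> lp; rewrite /prime_cofactor big_seq_cond.
apply: (big_ind (fun M => (l %| M)%N -> (l <= Q)%N && (l != p))).
- by rewrite dvdn1 => /eqP l1; rewrite l1 in lp.
- by move=> a b IHa IHb; rewrite Euclid_dvdM // => /orP[].
- move=> q /and3P[]; rewrite mem_index_iota => /andP[_ qQ] qp qnp.
  by rewrite dvdn_prime2 // => /eqP ->; rewrite -ltnS qQ.
Qed.

Lemma prime_cofactor_dvd Q p l : prime l -> (l <= Q)%N -> l != p ->
  (l %| prime_cofactor Q p)%N.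
Proof.
move=> lp lQ lnp; rewrite /prime_cofactor (big_rem l) ?mem_index_iota ?ltnS //=.
by rewrite lp lnp dvdn_mulr.
Qed.

(** Three ranges of [l]: at [p] the condition depends only on the class modulo [p ^ k]; for other
    [l <= Q] the Chinese remainder element [c'] is 1 modulo [M], so it avoids the primes over [l]
    altogether; beyond [Q] the sieve runs modulo [p ^ k * M]. *)
Lemma kfree_progression k p (c : OK) : (2 <= k)%N -> prime p ->
    (forall P, p%:R \in P -> ~ ideal_exp [set` P] k c) ->
  exists w, kfree K k (c + (p ^ k)%:R * w).
Proof.
move=> k2 pp cP; have [Q0 sieveQ] := sieve eB.
pose Q := maxn Q0 p; pose M := prime_cofactor Q p.
have pM : coprime (p ^ k) M.
  rewrite coprimeXl // prime_coprime //; apply/negP => /(dvd_prime_cofactor pp).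
  by rewrite eqxx andbF.
have M0 : (0 < M)%N.
  by rewrite /M /prime_cofactor prodn_cond_gt0 // => l /andP[/prime_gt0].
have /coprimezP[[u v] /= uv] : coprimez (p ^ k)%N M by [].
pose c' : OK := c + (p ^ k)%:R * (u%:~R * (1 - c)).
have c'E : c' = 1 + M%:R * (v%:~R * (c - 1)).
  have : u%:~R * (p ^ k)%:R + v%:~R * M%:R = 1 :> OK.
    by rewrite !pmulrn -!rmorphM -rmorphD uv.
  move=> uvO; rewrite /c'; apply/eqP; rewrite -subr_eq0; apply/eqP.
  transitivity ((1 - c) * (u%:~R * (p ^ k)%:R + v%:~R * M%:R - 1)); first by ring.
  by rewrite uvO subrr mulr0.
have [||l lp lQ|w wP] := sieveQ Q (p ^ k * M)%N c'.
- exact: leq_maxl.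
- by rewrite muln_gt0 expn_gt0 prime_gt0.
- rewrite Euclid_dvdM // negb_or; apply/andP; split; apply/negP.
    rewrite Euclid_dvdX // dvdn_prime2 // => /andP[/eqP lE _].
    by move: lQ; rewrite lE ltnNge leq_maxr.
  by move=> /(dvd_prime_cofactor lp)/andP[]; rewrite leqNgt lQ.
pose w' := u%:~R * (1 - c) + M%:R * w.
have xE : c + (p ^ k)%:R * w' = c' + (p ^ k * M)%:R * w.
  by rewrite natrM /w' /c'; ring.
exists w'; rewrite xE => P P0 Px.
have [l lp Pl] := rational_prime_in eB P0.
have [lQ|Ql] := leqP l Q; last first.
  by apply: (wP l P lp Ql Pl); apply: ideal_exp_sub Px.
have [lE|lnp] := eqVneq l p.
  rewrite lE in Pl; apply: (cP P Pl); apply: (ideal_exp_shift Pl (w := w')).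
  by rewrite xE.
have := ideal_exp_mem (ltnW k2) Px.
have /dvdnP[q ME] := prime_cofactor_dvd lp lQ lnp.
have lM : (prime_cofactor Q p)%:R \in P by rewrite ME natrM idealMr.
rewrite c'E natrM rpredDr; last by rewrite mulrAC idealMr.
by rewrite rpredDr ?idealr1 // mulrC idealMr.
Qed.

End Progression.

Lemma ord_sub_ndvdz n l (i j : 'I_n) : (n <= l)%N -> i != j ->
  ~~ (l %| i%:Z - j%:Z)%Z.
Proof.
have := ltn_ord i; have := ltn_ord j; rewrite -val_eqE dvdzE absz_nat /=.
move: (nat_of_ord i) (nat_of_ord j) => a b bn an nl ab.
by rewrite gtnNdvd //; lia.
Qed.

(** * Symmetries of the k-free integers *)

Section KFreeSymmetries.
Variables (K : fieldExtType rat) (k : nat).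
Hypothesis k2 : (2 <= k)%N.
Local Notation OK := (ringOfIntegers K).
Variable A : {additive OK -> OK}.
Hypothesis bijA : bijective A.
Implicit Types (P : prime_idealr OK) (l p : nat).

Lemma additive_intr (c : int) x : A (c%:~R * x) = c%:~R * A x.
Proof. by rewrite !mulrzl raddfMz. Qed.

Lemma additive_natr (n : nat) x : A (n%:R * x) = n%:R * A x.
Proof. by rewrite !mulr_natl raddfMn. Qed.

Section FromKFree.
Variables (m : nat) (theta : OK).
Hypothesis eB : basis_of {:K} (power_basis m theta).
Hypothesis AV : A @` kfree K k = kfree K k.

Lemma image_pow_mem l P x : prime l -> l%:R \in P -> ideal_exp [set` P] k x ->
  exists P', l%:R \in P' /\ A x \in P'.
Proof.
move=> lp Pl Px; apply: contrapT => /forallNP nP'.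
have [|w] := @kfree_progression _ _ _ eB k l (A x) k2 lp.
  move=> P' P'l P'Ax; apply: (nP' P'); split=> //.
  by apply: ideal_exp_mem P'Ax; apply: ltnW.
rewrite -AV => -[y Vy yE]; have [B AK BK] := bijA.
have {}yE : y = x + (l ^ k)%:R * B w.
  by apply: (can_inj AK); rewrite yE raddfD additive_natr BK.
apply: (Vy P (nonzero_above lp Pl)); rewrite yE; apply: ideal_expD => //.
by rewrite natrX mulrC; apply/ideal_expMl/ideal_exp_self.
Qed.

(* If [O / P] is the prime field and [P] is unramified, then [P = P^k + l O], so
   the statement for [P^k] extends to [P]. *)
Lemma image_mem l P x : prime l -> l%:R \in P -> unramified l P ->
    (forall y, exists c : int, y - c%:~R \in P) -> x \in P ->
  exists P', l%:R \in P' /\ A x \in P'.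
Proof.
move=> lp Pl [h Ph hP] deg1 Px.
have [b hb] := deg1 h.
have lb : ~~ (l %| b)%Z.
  by apply: contra Ph => lb; rewrite -(subrK b%:~R h) rpredD // (mem_ideal_int _ lp
    Pl).
have [s [t st]] := prime_bezout lp lb.
(* [s] inverts [h] modulo [P], so [q] is in [P] and [x * q ^+ k.-1] in [P^k]. The rest of [x] is a
   multiple of [h * x], hence of [l]. *)
pose q : OK := 1 - s%:~R * h.
have Pq : q \in P.
  have -> : q = t%:~R * l%:R - s%:~R * (h - b%:~R).
    rewrite /q -[X in X - _](mulr1z 1) -st rmorphD !rmorphM /= -pmulrn; ring.
  by rewrite rpredB ?idealMr.
have [g gE] : exists g, 1 - q ^+ k.-1 = (1 - q) * g.
  by rewrite -{1}(expr1n _ k.-1) subrXX; eexists.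
have [y hy] := hP x Px.
have xE : x = x * q ^+ k.-1 + l%:R * (s%:~R * g * y).
  rewrite mulrCA -hy; apply/eqP; rewrite addrC -subr_eq -[X in X - _]mulr1 -mulrBr gE.
  by apply/eqP; rewrite /q; ring.
have Pxq : ideal_exp [set` P] k (x * q ^+ k.-1).
  by have := ideal_expX k.-1 Px Pq; rewrite prednK // ltnW.
have [P' [P'l P'A]] := image_pow_mem lp Pl Pxq; exists P'; split=> //.
by rewrite xE raddfD additive_natr rpredD // mulrC idealMr.
Qed.

(* Pigeonhole on [u + i w], [i <= n]: two of the values of [A] lie in one prime
   above [l], which then contains both [A u] and [A w]. *)
Lemma square_mul x : A (x ^+ 2) * A 1 = A x ^+ 2.
Proof.
apply/eqP; rewrite -subr_eq0; set z := _ - _; apply: contraT => z0.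
have [d d0 unr] := almost_all_unramified eB.
(* The three terms make [P] unramified, keep [l] from dividing the nonzero norm of [z], and make the
   differences of pigeonhole indices invertible modulo [l]. *)
have [l [P [lp Bl Pl deg1]]] := degree_one_prime eB (`|d| + `|norm m theta z| + m.+2).
have ld : ~~ (l %| d)%Z.
  by rewrite dvdzE absz_nat gtnNdvd ?absz_gt0 //; apply: leq_ltn_trans Bl; lia.
have unrP := unr l P lp ld Pl.
have [c Pxc] := deg1 x.
pose u := x - c%:~R; pose w := x ^+ 2 - c%:~R ^+ 2.
have Pw : w \in P by rewrite /w subr_sqr mulrC idealMr.
have exP (i : 'I_m.+2) : exists P', l%:R \in P' /\ A (u + i%:R * w) \in P'.
  by apply: (image_mem lp Pl unrP deg1); rewrite rpredD ?idealMr.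
pose Pi i := projT1 (cid (exP i)).
have PiE i : l%:R \in Pi i /\ A (u + i%:R * w) \in Pi i by exact: (projT2 (cid (exP
  i))).
have [i [j [ij Pij]]] := primes_over_collide eB lp (fun i => (PiE i).1).
set P' := Pi j in Pij; have [P'l P'j] := PiE j; rewrite -/P' in P'l P'j.
have P'i := Pij _ (PiE i).2.
have P'w : A w \in P'.
  have : (i%:Z - j%:Z)%:~R * A w \in P'.
    have -> : (i%:Z - j%:Z)%:~R * A w = A (u + i%:R * w) - A (u + j%:R * w).
      by rewrite -additive_intr -raddfB rmorphB /= -!pmulrn; congr (A _); ring.
    exact: rpredB.
  rewrite prime_idealrM (mem_ideal_int _ lp P'l) (negPf (ord_sub_ndvdz _ ij)) //.
  by apply: leq_trans (ltnW Bl); apply: leq_addl.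
have P'u : A u \in P'.
  by move: P'j; rewrite raddfD additive_natr rpredDr // idealMr.
have : z \in P'.
  have AxE : A x = A u + c%:~R * A 1.
    by rewrite -additive_intr mulr1 -raddfD subrK.
  have Ax2E : A (x ^+ 2) = A w + c%:~R ^+ 2 * A 1.
    by rewrite -rmorphXn -additive_intr mulr1 -raddfD rmorphXn subrK.
  have -> : z = A 1 * A w - (A u + 2 * c%:~R * A 1) * A u.
    by rewrite /z AxE Ax2E; ring.
  by rewrite rpredB ?idealMr.
have [z' zz'] := norm_dvd eB z => P'z.
have : (norm m theta z)%:~R \in P' by rewrite -zz' mulrC idealMr.
rewrite (mem_ideal_int _ lp P'l) dvdzE absz_nat => /dvdn_leq.
rewrite absz_gt0 (norm_neq0 eB z0) => /(_ isT) lz.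
suff : (`|norm m theta z| < l)%N by rewrite ltnNge lz.
by apply: leq_ltn_trans Bl; rewrite addnAC leq_addl.
Qed.

Lemma A1_neq0 : A 1 != 0.
Proof.
by apply/eqP => A10; have /eqP := bij_inj bijA (etrans A10 (esym (raddf0 A)));
  rewrite oner_eq0.
Qed.

Lemma polarized_mul x y : A (x * y) * A 1 = A x * A y.
Proof.
have sqrE : A ((x + y) ^+ 2) = A (x ^+ 2) + 2%:R * A (x * y) + A (y ^+ 2).
  by rewrite -additive_natr -!raddfD; congr (A _); ring.
have h := square_mul (x + y); rewrite sqrE raddfD in h.
have two0 : 2%:R != 0 :> OK by rewrite natr_OK_neq0.
apply: (mulfI two0).
transitivity ((A (x ^+ 2) + 2%:R * A (x * y) + A (y ^+ 2)) * A 1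
              - A (x ^+ 2) * A 1 - A (y ^+ 2) * A 1); first by ring.
by rewrite h !square_mul; ring.
Qed.

Lemma symmetry_of_kfree : exists (tau : {rmorphism K -> K}) (eps : OK),
  [/\ bijective tau, eps \is a GRing.unit &
      forall x, intval (A x) = intval eps * tau (intval x)].
Proof.
have sc (z : K) : exists cy : int * OK, cy.1 != 0 /\ intval cy.2 = cy.1%:~R * z.
  by have [c c0 [y yE]] := integral_scale z; exists (c, y).
pose den z := (projT1 (cid (sc z))).1; pose num z := (projT1 (cid (sc z))).2.
have den0 z : den z != 0 by exact: (projT2 (cid (sc z))).1.
have numE z : intval (num z) = (den z)%:~R * z by exact: (projT2 (cid (sc z))).2.
have cK0 (c : int) : c != 0 -> c%:~R != 0 :> K.
  move=> c0; rewrite -(rmorph_int (@intval K)) -(rmorph0 (@intval K)).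
  by rewrite (inj_eq (@intval_inj K)) intr_OK_eq0.
have A1K : intval (A 1) != 0.
  by rewrite -(rmorph0 (@intval K)) (inj_eq (@intval_inj K)) A1_neq0.
pose tau z := intval (A (num z)) / ((den z)%:~R * intval (A 1)).
(* Independence of the chosen denominator lets sums and products be computed over a common one. *)
have tauE z (c : int) y : c != 0 -> intval y = c%:~R * z ->
    tau z = intval (A y) / (c%:~R * intval (A 1)).
  move=> c0 yE; have : c%:~R * num z = (den z)%:~R * y.
    by apply: intval_inj; rewrite !rmorphM !rmorph_int /= numE yE mulrCA.
  move/(congr1 (fun t => intval (A t)));
    rewrite /= !additive_intr !rmorphM !rmorph_int /= => h.
  have c0' := cK0 _ c0; have d0' := cK0 _ (den0 z).
  rewrite /tau; apply: (mulfI c0'); rewrite mulrA h; field.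
  by rewrite A1K c0' d0'.
have tauO y : tau (intval y) = intval (A y) / intval (A 1).
  by rewrite (@tauE _ 1 y) ?mul1r.
have tauB : zmod_morphism tau.
  move=> a b; have da := cK0 _ (den0 a); have db := cK0 _ (den0 b).
  rewrite (@tauE _ (den a * den b) ((den b)%:~R * num a - (den a)%:~R * num b)).
  - rewrite raddfB !additive_intr /tau rmorphB !rmorphM !rmorph_int /=; field.
    by rewrite A1K da db.
  - by rewrite mulf_neq0.
  - by rewrite rmorphB !rmorphM !rmorph_int /= !numE; ring.
have tauM : monoid_morphism tau.
  split; first by rewrite -(rmorph1 (@intval K)) tauO divff.
  move=> a b; have da := cK0 _ (den0 a); have db := cK0 _ (den0 b).
  rewrite (@tauE _ (den a * den b) (num a * num b)).
  - have := congr1 (@intval K) (polarized_mul (num a) (num b)).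
    rewrite !rmorphM /= => h; apply: (mulIf A1K).
    rewrite mulrAC h /tau; field; by rewrite A1K da db.
  - by rewrite mulf_neq0.
  - by rewrite !rmorphM /= !numE; ring.
pose tauR : {rmorphism K -> K} := HB.pack tau
  (GRing.isZmodMorphism.Build K K tau tauB) (GRing.isMonoidMorphism.Build K K tau
    tauM).
have AtauE x : intval (A x) = intval (A 1) * tauR (intval x).
  by rewrite /= tauO mulrC divfK.
exists tauR, (A 1); split=> //.
- have surj z : exists x, tauR x = z.
    have [B AK BK] := bijA.
    exists (intval (B (A 1 * num z)) / (den z)%:~R).
    rewrite fmorph_div rmorph_int /= tauO BK rmorphM /= numE.
    by field; rewrite A1K cK0 ?den0.
  exists (fun z => projT1 (cid (surj z))) => z; last exact: (projT2 (cid (surj z))).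
  by apply: (fmorph_inj tauR); exact: (projT2 (cid (surj (tauR z)))).
- have [B AK BK] := bijA.
  (* The inverse of [A 1] is [tau (B 1)], because [A 1 * tau (B 1) = A (B 1) = 1]; it is integral
     since [tau] preserves integer polynomial equations. *)
  have Itau : tauR (intval (B 1)) \in @isIntegral K.
    have /isIntegralP[q qm qB] := intvalP (B 1).
    apply/isIntegralP; exists q => //.
    have := rmorph_root tauR qB; rewrite -map_poly_comp.
    suff -> : map_poly (tauR \o intr) q = map_poly intr q by [].
    by apply: eq_map_poly => c; apply: (rmorph_int tauR).
  apply/asboolP; exists (RingOfIntegers Itau).
  by apply: intval_inj; rewrite rmorphM mulrC -AtauE BK.
Qed.

End FromKFree.
End KFreeSymmetries.

Section Preimage.
Variables (R : comNzRingType) (f : {rmorphism R -> R}) (P : prime_idealr R).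

Let preim_mem : pred R := fun x => f x \in P.

Let preim_memE x : (x \in preim_mem) = (f x \in P). Proof. by []. Qed.

Lemma preimage_idealr_closed : idealr_closed preim_mem.
Proof.
split=> [||a x y]; rewrite !preim_memE ?rmorph0 ?rpred0 ?rmorph1 ?idealr1 //.
by rewrite rmorphD rmorphM => Px Py; rewrite rpredD ?idealMr.
Qed.

Lemma preimage_prime_closed : prime_idealr_closed preim_mem.
Proof. by move=> x y; rewrite !preim_memE rmorphM prime_idealrM. Qed.

Definition preimage_prime : prime_idealr R :=
  HB.pack preim_mem (isIdealr.Build R _ preimage_idealr_closed)
    (isPrimeIdealrClosed.Build R _ preimage_prime_closed).

Lemma mem_preimage_prime x : (x \in preimage_prime) = (f x \in P).
Proof. by []. Qed.

End Preimage.

(** * Local conditions and their transport by automorphisms *)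

Section LocalSymmetries.
Variables (K : fieldExtType rat) (k : nat).
Local Notation OK := (ringOfIntegers K).
Variable A : {additive OK -> OK}.
Hypothesis bijA : bijective A.
Implicit Types (P : prime_idealr OK) (l p : nat).

Definition kfree_at p : set OK :=
  [set x | forall P, nonzero_ideal [set` P] -> p%:R \in P ->
    ~ ideal_exp [set` P] k x].

(** Representatives differ by a multiple of [p ^ k], which lies in [P^k] for each [P] over [p]. *)
Lemma kfree_atP p x : prime p ->
  kfree_loc K k p (\pi_({ideal_quot (principal ((p ^ k)%:R : OK))}) x)%qT <->
    kfree_at p x.
Proof.
move=> pp; split=> [[y Vy]|Vx]; last by exists x.
move=> /esym/eqP; rewrite -Quotient.idealrBE => /asboolP[w yw] P P0 Pp Px.
apply: (Vy P P0 Pp); apply: (@ideal_exp_shift _ P k p y w Pp).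
by rewrite -yw addrC subrK.
Qed.

Lemma kfree_locP x : kfree K k x <-> forall p, prime p -> kfree_at p x.
Proof.
split=> [Vx p pp P P0 _|Vx P P0]; first exact: Vx.
have [m [theta eB]] := integral_power_basis K.
by have [p pp Pp] := rational_prime_in eB P0; apply: (Vx p pp P P0 Pp).
Qed.

Lemma image_kfree_loc p : prime p ->
  (induced A @` kfree_loc K k p = kfree_loc K k p) <->
  (forall x, kfree_at p x <-> kfree_at p (A x)).
Proof.
move=> pp; have [B AK BK] := bijA; split=> [AVp x|Ax].
  rewrite -!(kfree_atP _ pp) -induced_pi -[in X in _ <-> X]AVp; split=> [Vx|[y Vy]].
    by exists (\pi x)%qT.
  by move/(bij_inj (induced_bij _ bijA)) <-.
apply/seteqP; split=> [_ [c Vc <-]|c Vc].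
  move: Vc; rewrite -[c]reprK induced_pi => Vc.
  by apply/(kfree_atP _ pp); rewrite -Ax -(kfree_atP _ pp).
exists (\pi_({ideal_quot (principal ((p ^ k)%:R : OK))}) (B (repr c)))%qT;
  last by rewrite induced_pi BK reprK.
by apply/(kfree_atP _ pp); rewrite Ax BK -(kfree_atP _ pp) reprK.
Qed.

Lemma image_kfree_of_loc :
    (forall p, prime p -> induced A @` kfree_loc K k p = kfree_loc K k p) ->
  A @` kfree K k = kfree K k.
Proof.
move=> AVp; have AV x : kfree K k x <-> kfree K k (A x).
  have Ax p (pp : prime p) := (image_kfree_loc pp).1 (AVp p pp) x.
  by rewrite !kfree_locP; split=> Vx p pp;
    [exact: (Ax p pp).1 (Vx p pp)|exact: (Ax p pp).2 (Vx p pp)].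
have [B AK BK] := bijA; apply/seteqP; split=> [_ [x Vx <-]|y Vy];
  first exact: (AV x).1 Vx.
by exists (B y); rewrite ?BK //; apply: (AV _).2; rewrite BK.
Qed.

Lemma kfree_loc_of_symmetry (tau : {rmorphism K -> K}) (eps : OK) p :
    eps \is a GRing.unit -> (forall x, intval (A x) = intval eps * tau (intval x)) ->
  prime p -> induced A @` kfree_loc K k p = kfree_loc K k p.
Proof.
move=> Ueps AtauE pp; have [B AK BK] := bijA.
(* [sigma] is the restriction of [tau] to the integers. Building its inverse from that of [A] keeps
   it integer-valued by construction, and contraction along either map transports the primes over
   [p]. *)
pose sigma x := eps^-1 * A x; pose rho x := B (eps * x).
have sigmaE x : intval (sigma x) = tau (intval x).
  by rewrite rmorphM /= AtauE mulrA -[_ * intval eps]rmorphM mulVr // rmorph1 mul1r.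
have sigmaK : cancel sigma rho by move=> x; rewrite /rho mulVKr // AK.
have rhoK : cancel rho sigma by move=> x; rewrite /sigma BK mulKr.
have sigmaB : zmod_morphism sigma.
  move=> x y; apply: intval_inj; transitivity (intval (sigma x) - intval (sigma y)).
    by rewrite !sigmaE !rmorphB.
  by rewrite rmorphB.
have sigmaM : monoid_morphism sigma.
  split=> [|x y]; apply: intval_inj; rewrite sigmaE; first by rewrite !rmorph1.
  transitivity (intval (sigma x) * intval (sigma y)); last by rewrite rmorphM.
  by rewrite !sigmaE !rmorphM.
pose sigmaR : {rmorphism OK -> OK} := HB.pack sigma
  (GRing.isZmodMorphism.Build OK OK sigma sigmaB)
  (GRing.isMonoidMorphism.Build OK OK sigma sigmaM).
have rhoB : zmod_morphism rho := can2_zmod_morphism (f := sigmaR) sigmaK rhoK.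
have rhoM : monoid_morphism rho := can2_monoid_morphism (f := sigmaR) sigmaK rhoK.
pose rhoR : {rmorphism OK -> OK} := HB.pack rho
  (GRing.isZmodMorphism.Build OK OK rho rhoB)
  (GRing.isMonoidMorphism.Build OK OK rho rhoM).
have nz f P : p%:R \in P -> nonzero_ideal [set` preimage_prime f P] /\ p%:R \in
  preimage_prime f P.
  move=> Pp; have Pp' : p%:R \in preimage_prime f P by rewrite mem_preimage_prime
    rmorph_nat.
  by split=> //; apply: nonzero_above pp Pp'.
apply/(image_kfree_loc pp) => x; split=> Vx P _ Pp Px.
  have [P0' Pp'] := nz sigmaR P Pp; apply: (Vx _ P0' Pp').
  have -> : x = rhoR (eps^-1 * A x) by exact: esym (sigmaK x).
  rewrite (rmorphM rhoR).
  by apply: ideal_exp_morph Px => y Py; rewrite mem_preimage_prime /= rhoK.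
have [P0' Pp'] := nz rhoR P Pp; apply: (Vx _ P0' Pp').
have -> : A x = eps * sigmaR x by rewrite /= /sigma mulVKr.
by apply: ideal_exp_morph Px => y Py; rewrite mem_preimage_prime /= sigmaK.
Qed.

End LocalSymmetries.

Theorem theorem1p1 (K : fieldExtType rat) (k : nat) (hk : (2 <= k)%N)
    (A : {additive ringOfIntegers K -> ringOfIntegers K})
    (bijA : bijective A) :
  let a := A @` kfree K k = kfree K k in
  let b := forall p : nat, prime p ->
    induced A @` kfree_loc K k p = kfree_loc K k p in
  let c := exists (tau : {rmorphism K -> K}) (eps : ringOfIntegers K),
    [/\ bijective tau, eps \is a GRing.unit &
        forall x, intval (A x) = intval eps * tau (intval x)] in
  (a <-> b) /\ (b <-> c).
Proof.
move=> a b c.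
have ba : b -> a by exact: image_kfree_of_loc.
have ac : a -> c.
  by have [m [theta eB]] := integral_power_basis K; apply: symmetry_of_kfree eB.
have cb : c -> b.
  by case=> tau [eps [_ Ueps AE]] p; apply: kfree_loc_of_symmetry Ueps AE.
split; first by split=> [/ac/cb|/ba].
by split=> [/ba/ac|/cb].
Qed.
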